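(* In the class $M_1^\circ(F)$ there exists a unique measure $\lambda=\lambda_F\in M_1^\circ(F)$ such that $$J_\psi(\lambda)=\min_{\mu\in M_1(F)}J_\psi(\mu).$$ The measure $\lambda$ is completely characterized by the following equilibrium condition (that is, $\lambda$ satisfies it, and $\lambda$ is the only measure in $M_1^\circ(F)$ satisfying it): there is a constant $w_F$ such that $$P^\lambda(z)+\psi(z)\equiv w_F\quad\text{for } z\in S(\lambda),\qquad P^\lambda(z)+\psi(z)\geq w_F\quad\text{for } z\in F\setminus S(\lambda).$$
   Context: Let $E:=[-1,1]$ and $D:=\overline{\mathbb C}\setminus E$, where $\overline{\mathbb C}$ is the Riemann sphere. Let $F:=\bigsqcup_{j=1}^p[c_j,d_j]\subset\mathbb R\setminus E$ be a finite disjoint union of compact intervals with $c_j<d_j$. Set $\varphi(z):=z+(z^2-1)^{1/2}$ for $z\in D$, with the branch chosen so that $(z^2-1)^{1/2}/z\to1$ as $z\to\infty$, and $\psi(z):=\log|\varphi(z)|$. $M_1(F)$ denotes the space of all unit (i.e. total mass one) positive Borel measures supported on $F$. $M_1^\circ(F)\subset M_1(F)$ is the subset of measures $\mu$ with finite logarithmic energy $I(\mu):=\iint_{F\times F}\log\frac1{|z-t|}\,d\mu(z)\,d\mu(t)<\infty$. $S(\mu)$ denotes the (closed) support of $\mu$. For $\mu\in M_1(F)$ put $$P^\mu(z):=\int_F\log\frac{|1-\varphi(z)\varphi(t)|}{|z-t|^2}\,d\mu(t),$$ $$J_\psi(\mu):=\iint_{F\times F}\Bigl\{\log\frac{|1-\varphi(z)\varphi(t)|}{|z-t|^2}+\psi(z)+\psi(t)\Bigr\}\,d\mu(z)\,d\mu(t)=\int_F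 P^\mu(z)\,d\mu(z)+2\int_F\psi(z)\,d\mu(z),$$ where these quantities take values in $(-\infty,+\infty]$. *)

(* Defs.v *)
From HB Require Import structures.
From mathcomp Require Import all_boot all_order all_algebra.
From mathcomp Require Import all_classical all_reals all_analysis.
From mathcomp Require Export complex.

Set Implicit Arguments.
Unset Strict Implicit.
Unset Printing Implicit Defensive.

Import Order.TTheory GRing.Theory Num.Theory.
Import numFieldNormedType.Exports.
Import ComplexField.Normc.

Local Open Scope classical_set_scope.
Local Open Scope ring_scope.
Local Open Scope complex_scope.

Section Defs.
Variable R : realType.
Implicit Types (z t : R[i]) (F : set R).

Local Notation borelR := (measurableTypeR R).
Implicit Types mu nu : probability borelR R.

(* [sqrtc] is the principal square root (nonnegative real part).  For z
   outside [-1, 1], 1 - z^-2 avoids the cut ]-oo, 0], so z * sqrtc (1 - z^-2)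
   is the branch of (z^2 - 1)^(1/2) that is equivalent to z at infinity. *)
Definition phi z : R[i] := z + z * sqrtc (1 - (z ^+ 2)^-1).

Definition psi z : R := ln (normc (phi z)).

(* The quotient and the logarithm are those of the extended reals: for
   z = t outside [-1, 1] the denominator vanishes, a / 0 = +oo for a > 0, and
   the value is +oo. *)
Definition log_kernel z t : \bar R :=
  lne ((normc (1 - phi z * phi t))%:E / (normc (z - t) ^+ 2)%:E)%E.

Definition M1 F : set (probability borelR R) := [set mu | mu (~` F) = 0%E].

(* Double integrals are iterated: the integrands are symmetric and, on a
   compact F outside [-1, 1], bounded below, so the order is irrelevant.  Here
   the integrand is log (1 / |z - t|), equal to +oo when z = t. *)
Definition energy F mu : \bar R :=
  (\int[mu]_(z in F) \int[mu]_(t in F) lne (`|(z : R) - (t : R)|%R%:E^-1))%E.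

Definition M1fin F : set (probability borelR R) :=
  [set mu | M1 F mu /\ (energy F mu < +oo)%E].

Definition msupport mu : set R :=
  [set x | forall U : set R, open U -> U x -> (0 < mu U)%E].

Definition potential F mu z : \bar R :=
  (\int[mu]_(t in F) log_kernel z (t : R)%:C)%E.

Definition Jpsi F mu : \bar R :=
  (\int[mu]_(z in F) \int[mu]_(t in F)
     (log_kernel (z : R)%:C (t : R)%:C
      + (psi (z : R)%:C)%:E + (psi (t : R)%:C)%:E))%E.

(* Inhabitants of [probability] are functions on all sets, so two of them
   represent the same Borel measure when they agree on measurable sets. *)
Definition same_measure mu nu : Prop :=
  forall A : set borelR, measurable A -> mu A = nu A.

Definition is_minimizer F mu : Prop :=
  M1 F mu /\ forall nu, M1 F nu -> (Jpsi F mu <= Jpsi F nu)%E.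

Definition equilibrium F mu : Prop :=
  exists w : R,
    (forall x : R, msupport mu x ->
       (potential F mu x%:C + (psi x%:C)%:E = w%:E)%E) /\
    (forall x : R, (F `\` msupport mu) x ->
       (w%:E <= potential F mu x%:C + (psi x%:C)%:E)%E).

End Defs.

(* Main.v *)
(* For x, t in F the branch phi satisfies
     2 |x - t| = |1 - phi(x) phi(t)| |1 / phi(x) - 1 / phi(t)|,
   so the kernel of J_psi is, up to a constant,
     log 1/|x - t| + log 1/|1/phi(x) - 1/phi(t)| + psi(x) + psi(t).
   On sets of diameter less than L, log (L / |d|) is an integral over v of the
   tents (1 - |d| e^v)^+ plus one more tent; they are multiples of
   autocorrelations of indicators of intervals of length e^-v.  Hence the energy
   of a difference mu - nu of two probability measures is a sum of nonnegative
   integrals of squares of mu [s, s + e^-v] - nu [s, s + e^-v]; it vanishes only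
   if mu = nu.  A minimizer
   exists because the quantile functions of a minimizing sequence have a
   subsequence converging almost everywhere (Helly), and the energy is lower
   semicontinuous along it by Fatou's lemma.  Positivity of the energy of
   differences then gives uniqueness, both of the minimizer and of the measure
   satisfying the equilibrium condition.  The first variation of J_psi in the
   direction of uniform measures on short intervals of F bounds the potential of
   the minimizer from below at every point of F, and lower semicontinuity forces
   equality on the support. *)

Require Import Defs.
From HB Require Import structures.
From mathcomp Require Import all_boot all_order all_algebra.
From mathcomp Require Import all_classical all_reals all_analysis.
From mathcomp Require Import measurable_realfun.
From mathcomp Require Import ring lra.
Import Order.TTheory GRing.Theory Num.Theory.
Import numFieldNormedType.Exports.
Local Open Scope classical_set_scope.
Local Open Scope ring_scope.
Set Implicit Arguments.
Unset Strict Implicit.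
Unset Printing Implicit Defensive.

(** * Mutual energies of nonnegative kernels and positivity on differences *)

Section mutual_energy.
Local Open Scope ereal_scope.
Context d (T : measurableType d) {R : realType}.
Local Notation P := (probability T R).
Implicit Types (k : T * T -> \bar R) (mu nu : P).

(** Energies may be infinite, so nothing is subtracted before finiteness is known. On F the kernel
    of J_psi differs by a constant from a sum of nonnegative kernels, the logarithms being log (L /
    |d|) truncated at 0, with L at least the diameters of F and of [-1, 1]. Tonelli then applies
    throughout, and positivity reads 2 E(mu, nu) <= E(mu, mu) + E(nu, nu). The kernel is used in two
    forms. The one with 1/phi exhibits positivity. The other, 2 log 1/|x - t| plus a function
    bounded on F, shows that finite logarithmic energy and finite J_psi are the same condition, and
    it controls averages over intervals. The obstacle in the equilibrium condition is that a point
    mass has infinite energy, so minimality cannot be tested by adding mass at a point. Every point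
    of F lies in arbitrarily short intervals contained in F; the averages over them are dominated by
    the kernel plus a constant, and dominated convergence gives the inequality at every point rather
    than almost everywhere. *)

Definition mutual_energy k mu nu := \int[mu]_x \int[nu]_y k (x, y).

(* Nonnegativity of the energy of the signed measure mu - nu, written without
   subtraction because the terms may be infinite. *)
Definition diff_posdef k := forall mu nu,
  mutual_energy k mu nu + mutual_energy k mu nu <=
  mutual_energy k mu mu + mutual_energy k nu nu.

Lemma integral_prob_cst mu (w : \bar R) : \int[mu]_x w = w.
Proof.
rewrite integral_cst// -[RHS]mule1; congr (_ * _); exact: probability_setT.
Qed.

Lemma mutual_energy_ge0 k mu nu : (forall p, 0 <= k p) ->
  0 <= mutual_energy k mu nu.
Proof.
by move=> k0; apply: integral_ge0 => x _; apply: integral_ge0 => y _.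
Qed.

Lemma mutual_energyC k mu nu : measurable_fun setT k -> (forall p, 0 <= k p) ->
  (forall x y, k (x, y) = k (y, x)) ->
  mutual_energy k mu nu = mutual_energy k nu mu.
Proof.
move=> mk k0 sk; rewrite /mutual_energy (fubini_tonelli k mk k0).
by apply: eq_integral => y _; apply: eq_integral => x _; rewrite sk.
Qed.

Lemma mutual_energyD k1 k2 mu nu :
  measurable_fun setT k1 -> (forall p, 0 <= k1 p) ->
  measurable_fun setT k2 -> (forall p, 0 <= k2 p) ->
  mutual_energy (k1 \+ k2) mu nu = mutual_energy k1 mu nu + mutual_energy k2 mu nu.
Proof.
move=> mk1 k10 mk2 k20; rewrite /mutual_energy.
rewrite -ge0_integralD//=.
- apply: eq_integral => x _; rewrite ge0_integralD//.
  + exact: measurable_fun_pair2.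
  + exact: measurable_fun_pair2.
- by move=> x _; apply: integral_ge0.
- exact: measurable_fun_fubini_tonelli_F.
- by move=> x _; apply: integral_ge0.
- exact: measurable_fun_fubini_tonelli_F.
Qed.

Lemma diff_posdefD k1 k2 :
  measurable_fun setT k1 -> (forall p, 0 <= k1 p) -> diff_posdef k1 ->
  measurable_fun setT k2 -> (forall p, 0 <= k2 p) -> diff_posdef k2 ->
  diff_posdef (k1 \+ k2).
Proof.
move=> mk1 k10 pk1 mk2 k20 pk2 mu nu; rewrite !mutual_energyD// addeACA.
by rewrite [leRHS]addeACA; exact: leeD.
Qed.

Lemma mutual_energy_scale k (c : R) mu nu : (0 <= c)%R ->
  measurable_fun setT k -> (forall p, 0 <= k p) ->
  mutual_energy (fun p => c%:E * k p) mu nu = c%:E * mutual_energy k mu nu.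
Proof.
move=> c0 mk k0; rewrite /mutual_energy -ge0_integralZl//=.
- apply: eq_integral => x _; rewrite ge0_integralZl//.
  exact: measurable_fun_pair2.
- exact: measurable_fun_fubini_tonelli_F.
- by move=> x _; apply: integral_ge0.
Qed.

Lemma diff_posdef_scale k (c : R) : (0 <= c)%R ->
  measurable_fun setT k -> (forall p, 0 <= k p) -> diff_posdef k ->
  diff_posdef (fun p => c%:E * k p).
Proof.
move=> c0 mk k0 pk mu nu; rewrite !mutual_energy_scale//.
rewrite -!ge0_muleDr ?mutual_energy_ge0//.
by apply: lee_pmul => //; rewrite adde_ge0// mutual_energy_ge0.
Qed.

(** Packing mu and nu into the product probability [mn] reduces the exchange of three integrals to
    Tonelli for the two factors m and [mn]. *)
Lemma mutual_energy_integral d' (U : measurableType d')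
    (m : {sigma_finite_measure set U -> \bar R}) (g : U * (T * T) -> \bar R)
    mu nu : measurable_fun setT g -> (forall p, 0 <= g p) ->
  mutual_energy (fun p => \int[m]_t g (t, p)) mu nu =
  \int[m]_t mutual_energy (fun p => g (t, p)) mu nu.
Proof.
move=> mg g0; pose mn : probability (T * T)%type R := mu \x nu.
transitivity (\int[mn]_p \int[m]_t g (t, p)).
  rewrite fubini_tonelli1//; last by move=> p; apply: integral_ge0.
  exact: (measurable_fun_fubini_tonelli_G (m1 := m) g).
rewrite -(fubini_tonelli (m1 := m) (m2 := mn) g)//.
apply: eq_integral => t _; rewrite fubini_tonelli1//.
exact: measurable_fun_pair2.
Qed.

Lemma measurable_mutual_energy d' (U : measurableType d')
    (g : U * (T * T) -> \bar R)
    mu nu : measurable_fun setT g -> (forall p, 0 <= g p) ->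
  measurable_fun setT (fun t => mutual_energy (fun p => g (t, p)) mu nu).
Proof.
move=> mg g0; pose h (z : (U * T) * T) := g (z.1.1, (z.1.2, z.2)).
have mh : measurable_fun setT h.
  apply: measurableT_comp => //; apply: measurable_fun_pair.
    exact: measurableT_comp measurable_fst.
  by apply: measurable_fun_pair => //; exact: measurableT_comp measurable_fst.
have mH := measurable_fun_fubini_tonelli_F (m2 := nu) h mh (fun=> g0 _).
apply: (measurable_fun_fubini_tonelli_F (m2 := mu) (fubini_F nu h) mH).
by move=> z; apply: integral_ge0 => y _; exact: g0.
Qed.

(** Since the inequality contains only sums, it can be integrated in t even where some terms are
    infinite. Superpositions of positive kernels are thus positive. *)
Lemma diff_posdef_integral d' (U : measurableType d')
    (m : {sigma_finite_measure set U -> \bar R}) (g : U * (T * T) -> \bar R) :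
  measurable_fun setT g -> (forall p, 0 <= g p) ->
  (forall t, diff_posdef (fun p => g (t, p))) ->
  diff_posdef (fun p => \int[m]_t g (t, p)).
Proof.
move=> mg g0 pg mu nu; rewrite !mutual_energy_integral//.
suff intD (f1 f2 f3 : U -> \bar R) :
    (forall t, 0 <= f1 t) -> (forall t, 0 <= f2 t) -> (forall t, 0 <= f3 t) ->
    measurable_fun setT f1 -> measurable_fun setT f2 -> measurable_fun setT f3 ->
    (forall t, f1 t + f1 t <= f2 t + f3 t) ->
    \int[m]_t f1 t + \int[m]_t f1 t <= \int[m]_t f2 t + \int[m]_t f3 t.
  by apply: intD => [t|t|t||||t]; do ?exact: mutual_energy_ge0;
    do ?exact: measurable_mutual_energy; exact: pg.
move=> f10 f20 f30 mf1 mf2 mf3 f123; rewrite -!ge0_integralD//.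
apply: ge0_le_integral => //; do ?exact: emeasurable_funD.
by move=> t _; apply: adde_ge0.
Qed.

Lemma mutual_energy_comp k (u : T -> T) (mu' nu' : P) mu nu :
  measurable_fun setT u -> measurable_fun setT k -> (forall p, 0 <= k p) ->
  mu' = pushforward mu u :> (set T -> \bar R) ->
  nu' = pushforward nu u :> (set T -> \bar R) ->
  mutual_energy (fun p => k (u p.1, u p.2)) mu nu = mutual_energy k mu' nu'.
Proof.
move=> mcu mk k0 mu'E nu'E; rewrite /mutual_energy.
have mG := measurable_fun_fubini_tonelli_F (m2 := nu') k mk k0.
have -> : \int[mu']_x \int[nu']_y k (x, y) = \int[mu]_x \int[nu']_y k (u x, y).
  rewrite mu'E ge0_integral_pushforward//.
  by move=> x _; apply: integral_ge0.
apply: eq_integral => x _; rewrite nu'E ge0_integral_pushforward//.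
exact: measurable_fun_pair2.
Qed.

(** The energies are those of the images of mu and nu under u, which are again probabilities. With u
    = 1/phi this handles the second logarithm of the kernel. *)
Lemma diff_posdef_comp k (u : T -> T) :
  measurable_fun setT u -> measurable_fun setT k -> (forall p, 0 <= k p) ->
  diff_posdef k -> diff_posdef (fun p => k (u p.1, u p.2)).
Proof.
move=> mcu mk k0 pk mu nu.
pose U : {mfun T >-> T} := HB.pack u (isMeasurableFun.Build _ _ _ _ _ mcu).
have H m m' := @mutual_energy_comp k u (distribution m U) (distribution m' U)
  m m' mcu mk k0 erefl erefl.
by rewrite !H.
Qed.

End mutual_energy.

(** * The truncated logarithm as a superposition of tents *)

Section logplus.
Context {R : realType}.
Local Notation mu := (@lebesgue_measure R).
Implicit Types L d v x y : R.

(** The truncation at 0 makes the kernel nonnegative on the whole line and is inactive for |d| <= L.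
    The value at d = 0 is set apart because division by 0 and [ln] at 0 return 0, where +oo is
    meant. *)
Definition logplus (L d : R) : \bar R :=
  if d == 0 then +oo%E else (Num.max 0 (ln (L / `|d|)))%:E.

(* expR (- v) * tent v (x - y) is the length of the set of the s such that both
   x and y lie in the window [s, s + expR (- v)]. *)
Definition tent v d : R := Num.max 0 (1 - `|d| * expR v).

Lemma logplus_ge0 L d : (0 <= logplus L d)%E.
Proof. by rewrite /logplus; case: ifP => // _; rewrite lee_fin le_max lexx. Qed.

Lemma tent_ge0 v d : 0 <= tent v d. Proof. by rewrite /tent le_max lexx. Qed.

Lemma integral_tent L d : 0 < L -> 0 < `|d| < L ->
  (\int[mu]_v (if (- ln L <= v)%R then tent v d else 0)%:E =
   (ln (L / `|d|) - 1 + `|d| / L)%:E)%E.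
Proof.
move=> L0 /andP[a0 aL]; set a := `|d| in a0 aL *.
have cb : - ln L < - ln a by rewrite ltrN2 ltr_ln ?posrE.
pose F v : R := v - a * expR v.
have dF x : is_derive x 1 F (1 - a * expR x).
  exact: is_deriveB (is_derive_id _ _) (is_deriveZ a (is_derive_expR x)).
have cF : continuous F.
  by move=> x; apply/differentiable_continuous/derivable1_diffP; have [] := dF x.
transitivity (\int[mu]_(v in `[(- ln L)%R, (- ln a)%R]) (1 - a * expR v)%:E)%E.
  rewrite [RHS]integral_mkcond; apply: eq_integral => v _; rewrite patchE.
  rewrite mem_setE in_itv/= /tent -/a.
  have [cv|//] := leP (- ln L) v; have [vb|bv] /= := leP v (- ln a).
    rewrite max_r// subr_ge0 -[a]lnK ?posrE// -expRD expR_le1; lra.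
  rewrite max_l// subr_le0 -[a]lnK ?posrE// -expRD -expR0 ler_expR; lra.
rewrite (@continuous_FTC2 _ _ F)//.
- rewrite -EFinB /F !expRN !lnK ?posrE// mulfV ?gt_eqF// ln_div ?posrE//.
  congr EFin; ring.
- apply: continuous_subspaceT => x.
  apply: cvgB; first exact: cvg_cst.
  by apply: cvgMr; exact: continuous_expR.
- split.
  + by move=> x _; have [] := dF x.
  + by apply: cvg_at_right_filter; exact: cF.
  + by apply: cvg_at_left_filter; exact: cF.
- by move=> x _; rewrite derive1E; have [_ ->] := dF x.
Qed.

(** For 0 < |d| < L the integral misses [ln (L / |d|)] by 1 - |d| / L, which is exactly the tent at
    v = - ln L. For |d| >= L both sides vanish, and at d = 0 the integrand is 1 on a half-line. *)
Lemma logplusE L d : 0 < L ->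
  logplus L d = (\int[mu]_v (if (- ln L <= v)%R then tent v d else 0)%:E
                 + (tent (- ln L) d)%:E)%E.
Proof.
move=> L0; rewrite /logplus; have [->|d0] := eqVneq d 0.
  rewrite (_ : integral _ _ _ = +oo%E) ?addye//.
  transitivity (\int[mu]_(v in `[(- ln L)%R, +oo[) 1)%E.
    rewrite [RHS]integral_mkcond; apply: eq_integral => v _; rewrite patchE.
    rewrite mem_setE in_itv/= andbT /tent normr0 mul0r subr0 max_r//.
    by case: ifP.
  by rewrite integral_cst//= lebesgue_measure_itv/= ltry mul1e.
have a0 : 0 < `|d| by rewrite normr_gt0.
have [dL|Ld] := ltP `|d| L.
  rewrite integral_tent ?a0//= -EFinD /tent expRN lnK ?posrE//.
  rewrite !max_r ?subr_ge0 ?ler_pdivrMr ?mul1r ?ltW//.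
    by congr EFin; ring.
  by rewrite ln_gt0// ltr_pdivlMr ?mul1r.
rewrite integral0_eq ?add0e => [|v _]; last first.
  case: ifP => // Lv; rewrite /tent max_l// subr_le0.
  rewrite -ler_expR expRN lnK ?posrE// in Lv.
  by rewrite -(@divff _ L) ?gt_eqF// ler_pM// ?invr_ge0 ltW.
rewrite /tent expRN lnK ?posrE// !max_l// ?subr_le0 ?ler_pdivlMr ?mul1r//.
by rewrite ln_le0// ler_pdivrMr ?mul1r.
Qed.

End logplus.

(** * Probability measures determined by rays *)

Section rays.
Local Open Scope ereal_scope.
Context {R : realType}.
Local Notation T := (measurableTypeR R).
Local Notation P := (probability T R).
Implicit Types (mu nu : P).

Lemma same_measure_rays mu nu :
  (forall c, mu `]-oo, c]%classic = nu `]-oo, c]%classic) -> same_measure mu nu.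
Proof.
move=> munu A mA.
apply: (@measure_unique _ R T (@RGenOInfty.G R)
  (fun n => `](- n%:R)%R, +oo[%classic) _ _ _ _ mu nu) => //.
- exact: RGenOInfty.measurableE.
- move=> _ _ [x ->] [y ->]; exists (Num.max x y).
  by apply/seteqP; split=> z /=; rewrite !in_itv/= !andbT gt_max => /andP.
- by move=> n; exists (- n%:R)%R.
- rewrite -subTset => x _; exists (Num.truncn `|x|).+1 => //=.
  by rewrite in_itv/= andbT ltrNl (le_lt_trans (ler_norm _))// normrN truncnS_gt.
- move=> _ [x ->].
  have rayC (m : P) : m `]x, +oo[%classic = 1 - m `]-oo, x]%classic.
    by rewrite -probability_setC// setCitvl.
  by rewrite [LHS]rayC [RHS]rayC munu.
- by move=> n; apply: le_lt_trans (probability_le1 _ _) _; rewrite ?ltry.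
Qed.

(** Distribution functions are right continuous, so agreement at points arbitrarily close to c on
    its right is enough. Windows will be known to agree only for almost every starting point. *)
Lemma rays_dense mu nu :
  (forall c e : R, (0 < e)%R ->
    exists2 c' : R, (c < c' < c + e)%R & mu `]-oo, c']%classic = nu `]-oo, c']%classic) ->
  forall c, mu `]-oo, c]%classic = nu `]-oo, c]%classic.
Proof.
move=> dense c.
have /choice[u uP] : forall n : nat, exists c' : R,
    (c < c' < c + n.+1%:R^-1)%R /\ mu `]-oo, c']%classic = nu `]-oo, c']%classic.
  by move=> n; have [|c' ? ?] := dense c (n.+1%:R^-1)%R; [rewrite invr_gt0|exists c'].
pose X : {mfun T >-> R} := HB.pack (idfun : T -> R)
  (@isMeasurableFun.Build _ _ T R (idfun : T -> R) (@measurable_id _ _ setT)).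
have rc (m : P) : m `]-oo, u n]%classic @[n --> \oo] --> m `]-oo, c]%classic.
  have fc : m `]-oo, c]%classic = (fine (m `]-oo, c]%classic))%:E.
    by rewrite fineK// fin_num_measure.
  have : cdf (X : {RV m >-> R}) x @[x --> c^'+] --> (fine (m `]-oo, c]%classic))%:E.
    by rewrite -fc; exact: cdf_right_continuous.
  rewrite fc => /cvge_at_rightP; apply; split => [n|]; first by have [/andP[]] := uP n.
  apply: (@squeeze_cvgr _ _ _ _ (fun=> c) (fun n => c + n.+1%:R^-1)%R).
  - near=> n; have [/andP[cu uc] _] := uP n; by rewrite (ltW cu) (ltW uc).
  - exact: cvg_cst.
  - rewrite -[X in _ --> X]addr0; apply: cvgD; first exact: cvg_cst.
    by apply: cvg_harmonic.
have := rc mu; under eq_fun do rewrite (uP _).2.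
by move=> /(cvg_unique _)/(_ (rc nu)); apply.
Unshelve. all: by end_near. Qed.

End rays.

(** * Positivity of the tent kernels *)

Section tent_energy.
Local Open Scope ereal_scope.
Context {R : realType}.
Local Notation T := (measurableTypeR R).
Local Notation P := (probability T R).
Local Notation leb := (@lebesgue_measure R).
Implicit Types (mu nu : P) (v s : R).

Definition window v s : set T := `[s, (s + expR (- v))%R]%classic.

(** For fixed v and s this kernel has rank one: a function of x times the same function of y. Its
    energy is the product of the masses of one window. *)
Definition box v (q : T * (T * T)) : \bar R :=
  (\1_(window v q.1) q.2.1)%:E * (\1_(window v q.1) q.2.2)%:E.

Lemma measurable_window v s : measurable (window v s).
Proof. exact: measurable_itv. Qed.

Lemma indic_window v s (x : T) :
  \1_(window v s) x = \1_`[(x - expR (- v))%R, x] s :> R.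
Proof.
rewrite !indicE !mem_setE !in_itv/= lerBlDr.
by rewrite andbC.
Qed.

Lemma measurable_indic_window v :
  measurable_fun setT (fun p : T * T => \1_(window v p.1) p.2 : R).
Proof.
rewrite (_ : (fun _ => _) = (fun p : T * T =>
    if (p.1 <= p.2)%R && (p.2 <= p.1 + expR (- v))%R then 1%R else 0%R)); last first.
  apply/funext => p; rewrite indicE mem_setE in_itv/=.
  by case: ifP => _.
apply: measurable_fun_ifT => //; apply: measurable_and.
- exact: measurable_fun_ler.
- by apply: measurable_fun_ler => //; exact: measurable_funD.
Qed.

Lemma measurable_box v : measurable_fun setT (box v).
Proof.
apply: emeasurable_funM; apply/measurable_EFinP.
- apply: (measurableT_comp (measurable_indic_window v)
    (g := fun q : T * (T * T) => (q.1, q.2.1))).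
  apply: measurable_fun_pair => //.
  exact: measurableT_comp measurable_fst measurable_snd.
- apply: (measurableT_comp (measurable_indic_window v)
    (g := fun q : T * (T * T) => (q.1, q.2.2))).
  apply: measurable_fun_pair => //.
  exact: measurableT_comp measurable_snd measurable_snd.
Qed.

Lemma box_ge0 v q : 0 <= box v q. Proof. by rewrite mule_ge0// lee_fin. Qed.

Lemma tent_box v (x y : T) :
  (tent v (x - y))%:E = (expR v)%:E * \int[leb]_s box v (s, (x, y)).
Proof.
have -> : \int[leb]_s box v (s, (x, y)) =
    leb `[(Num.max x y - expR (- v))%R, Num.min x y]%classic.
  rewrite -[X in leb X]setIT -integral_indic//; apply: eq_integral => s _.
  rewrite /box/= !indic_window !indicE !mem_setE -EFinM -natrM mulnb !in_itv/=.
  rewrite le_min (lerBlDr (Num.max x y)) ge_max -!lerBlDr.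
  by case: (_ <= s)%R; case: (_ <= s)%R; case: (s <= _)%R; case: (s <= _)%R.
rewrite lebesgue_measure_itv/= lte_fin /tent.
have maxB : (Num.max x y - Num.min x y = `|x - y|)%R.
  by case: (ltgtP x y) => xy; rewrite ?xy ?subrr ?normr0//;
    [rewrite ltr0_norm ?opprB// subr_lt0|rewrite gtr0_norm// subr_gt0].
have e0 := expR_gt0 v.
have -> : (Num.min x y = Num.max x y - `|x - y|)%R by lra.
have eV : (expR v * expR (- v) = 1)%R by rewrite expRN mulfV// gt_eqF.
rewrite ltrD2l ltrN2; case: ltP => h.
  rewrite -EFinD -EFinM -[in LHS]eV; congr EFin; rewrite max_r; first by ring.
  by rewrite subr_ge0 mulrC ler_pM2l// ltW.
by rewrite mule0 max_l// subr_le0 -eV mulrC ler_pM2r.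
Qed.

Lemma mutual_energy_box v s mu nu :
  mutual_energy (fun p => box v (s, p)) mu nu = mu (window v s) * nu (window v s).
Proof.
have mw := measurable_window v s.
have mi : measurable_fun setT (fun x : T => (\1_(window v s) x : R)%:E).
  exact/measurable_EFinP.
rewrite /mutual_energy /box/=.
under eq_integral do rewrite ge0_integralZl ?lee_fin// integral_indic// setIT.
by rewrite ge0_integralZr// integral_indic// setIT.
Qed.

Lemma diff_posdef_box v s : diff_posdef (fun p => box v (s, p)).
Proof.
move=> mu nu; rewrite !mutual_energy_box.
have mw := measurable_window v s.
rewrite -(@fineK _ (mu _)) ?fin_num_measure// -(@fineK _ (nu _)) ?fin_num_measure//.
set a := fine (mu _); set b := fine (nu _).
by rewrite -!EFinM -!EFinD lee_fin; have := sqr_ge0 (a - b); rewrite expr2; lra.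
Qed.

Lemma diff_posdef_tent v : diff_posdef (fun p : T * T => (tent v (p.1 - p.2))%:E).
Proof.
rewrite (_ : (fun p => _) = (fun p => (expR v)%:E * \int[leb]_s box v (s, p))).
  apply: diff_posdef_scale.
  - exact: expR_ge0.
  - apply: (measurable_fun_fubini_tonelli_G (m1 := leb) (box v)).
    + exact: measurable_box.
    + exact: box_ge0.
  - by move=> p; apply: integral_ge0 => s _; exact: box_ge0.
  - apply: diff_posdef_integral; first exact: measurable_box.
    + exact: box_ge0.
    + exact: diff_posdef_box.
by apply/funext => -[x y]; rewrite tent_box.
Qed.

End tent_energy.

(** * Energy of the truncated logarithm *)

Section logplus_energy.
Local Open Scope ereal_scope.
Context {R : realType}.
Local Notation T := (measurableTypeR R).
Local Notation P := (probability T R).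
Local Notation leb := (@lebesgue_measure R).
Implicit Types (mu nu : P) (v s L : R).

Definition tent_kernel v (p : T * T) : \bar R := (tent v (p.1 - p.2))%:E.

Definition tail_kernel L (q : T * (T * T)) : \bar R :=
  (if (- ln L <= q.1)%R then tent q.1 (q.2.1 - q.2.2) else 0%R)%:E.

Definition logplus_kernel L (p : T * T) : \bar R := logplus L (p.1 - p.2).

Lemma measurable_tent :
  measurable_fun setT (fun q : T * (T * T) => tent q.1 (q.2.1 - q.2.2)).
Proof.
apply: measurable_maxr => //; apply: measurable_funB => //.
apply: measurable_funM; last exact: measurableT_comp.
apply: measurableT_comp => //; apply: measurable_funB.
- exact: measurableT_comp measurable_fst measurable_snd.
- exact: measurableT_comp measurable_snd measurable_snd.
Qed.

Lemma measurable_tail_kernel L : measurable_fun setT (tail_kernel L).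
Proof.
apply/measurable_EFinP; apply: measurable_fun_ifT => //.
- exact: measurable_fun_ler.
- exact: measurable_tent.
Qed.

Lemma tail_kernel_ge0 L q : 0 <= tail_kernel L q.
Proof. by rewrite lee_fin; case: ifP => // _; exact: tent_ge0. Qed.

Lemma measurable_tent_kernel v : measurable_fun setT (tent_kernel v).
Proof.
apply/measurable_EFinP; apply: (measurableT_comp measurable_tent (g := pair v)).
exact: pair1_measurable.
Qed.

Lemma tent_kernel_ge0 v p : 0 <= tent_kernel v p.
Proof. by rewrite lee_fin tent_ge0. Qed.

Lemma logplus_kernelE L : (0 < L)%R -> logplus_kernel L =
  (fun p => \int[leb]_v tail_kernel L (v, p)) \+ tent_kernel (- ln L).
Proof. by move=> L0; apply/funext => p; rewrite /logplus_kernel logplusE. Qed.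

Lemma measurable_integral_tail L :
  measurable_fun setT (fun p => \int[leb]_v tail_kernel L (v, p)).
Proof.
apply: (measurable_fun_fubini_tonelli_G (m1 := leb) (tail_kernel L)).
- exact: measurable_tail_kernel.
- exact: tail_kernel_ge0.
Qed.

Lemma measurable_logplus_kernel L : (0 < L)%R ->
  measurable_fun setT (logplus_kernel L).
Proof.
move=> L0; rewrite logplus_kernelE//; apply: emeasurable_funD.
- exact: measurable_integral_tail.
- exact: measurable_tent_kernel.
Qed.

Lemma logplus_kernel_ge0 L p : 0 <= logplus_kernel L p.
Proof. exact: logplus_ge0. Qed.

Lemma diff_posdef_tail L :
  diff_posdef (fun p => \int[leb]_v tail_kernel L (v, p)).
Proof.
apply: diff_posdef_integral.
- exact: measurable_tail_kernel.
- exact: tail_kernel_ge0.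
- move=> v; rewrite /tail_kernel/=.
  have [_|_] := boolP (- ln L <= v)%R.
    exact: diff_posdef_tent.
  have E0 (m1 m2 : P) : mutual_energy (fun=> 0%R%:E) m1 m2 = 0.
    by apply: integral0_eq => x _; apply: integral0_eq.
  by move=> mu nu; rewrite !E0.
Qed.

Lemma diff_posdef_logplus L : (0 < L)%R -> diff_posdef (logplus_kernel L).
Proof.
move=> L0; rewrite logplus_kernelE//; apply: diff_posdefD.
- exact: measurable_integral_tail.
- by move=> p; apply: integral_ge0 => v _; exact: tail_kernel_ge0.
- exact: diff_posdef_tail.
- exact: measurable_tent_kernel.
- exact: tent_kernel_ge0.
- exact: diff_posdef_tent.
Qed.

Lemma tent_energyE v mu nu : mutual_energy (tent_kernel v) mu nu =
  (expR v)%:E * \int[leb]_s (mu (window v s) * nu (window v s)).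
Proof.
have -> : tent_kernel v = fun p => (expR v)%:E * \int[leb]_s box v (s, p).
  by apply/funext => -[x y]; rewrite -tent_box.
have mb := measurable_box v.
rewrite mutual_energy_scale ?expR_ge0//; last 2 first.
- apply: (measurable_fun_fubini_tonelli_G (m1 := leb) (box v)) => //.
  exact: box_ge0.
- by move=> p; apply: integral_ge0 => s _; exact: box_ge0.
rewrite mutual_energy_integral//; last exact: box_ge0.
by under eq_integral do rewrite mutual_energy_box.
Qed.

Lemma tent_energy_fin v mu nu : mutual_energy (tent_kernel v) mu nu \is a fin_num.
Proof.
rewrite ge0_fin_numE; last by apply: mutual_energy_ge0 => p; exact: tent_kernel_ge0.
have mt := measurable_tent_kernel v; have t0 := @tent_kernel_ge0 v.
apply: (@le_lt_trans _ _ (\int[mu]_x \int[nu]_y 1)).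
  apply: ge0_le_integral => //.
  - by move=> x _; apply: integral_ge0.
  - exact: measurable_fun_fubini_tonelli_F.
  - move=> x _; apply: ge0_le_integral => //.
    + exact: measurable_fun_pair2.
    + move=> y _; rewrite lee_fin/= /tent ge_max ler01 lerBlDr lerDl.
      by rewrite mulr_ge0 ?expR_ge0.
by under eq_integral do rewrite integral_prob_cst; rewrite integral_prob_cst ltry.
Qed.

Lemma measurable_prob_window v mu : measurable_fun setT (fun s => mu (window v s)).
Proof.
apply: (eq_measurable_fun
    (fun s => \int[mu]_x ((\1_(window v s) x : R)%:E))) => [s _|].
  by rewrite integral_indic ?setIT//; exact: measurable_window.
apply: (measurable_fun_fubini_tonelli_F (m2 := mu)
  (fun p : T * T => (\1_(window v p.1) p.2 : R)%:E)) => [|p]; last by rewrite lee_fin.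
by have /measurable_EFinP := measurable_indic_window v.
Qed.

(** The gap between the two sides is exp v times the integral of the square of mu (window) - nu
    (window). Finiteness of the mixed energy allows the cancellation, and a nonnegative function
    with zero integral vanishes almost everywhere. *)
Lemma tent_energy_eq v mu nu :
  mutual_energy (tent_kernel v) mu mu + mutual_energy (tent_kernel v) nu nu <=
  mutual_energy (tent_kernel v) mu nu + mutual_energy (tent_kernel v) mu nu ->
  {ae leb, forall s, mu (window v s) = nu (window v s)}.
Proof.
have ma := measurable_prob_window v mu; have mb := measurable_prob_window v nu.
have ffa (m : P) s : m (window v s) = (fine (m (window v s)))%:E.
  by rewrite fineK// fin_num_measure//; exact: measurable_window.
have := tent_energy_fin v mu nu.
rewrite !tent_energyE.
set a := fun s => mu (window v s) in ma *; set b := fun s => nu (window v s) in mb *.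
have a0 s : 0 <= a s by [].
have b0 s : 0 <= b s by [].
pose h s : \bar R := ((fine (a s) - fine (b s)) ^+ 2)%:E.
have mh : measurable_fun setT h.
  apply/measurable_EFinP/measurable_funX/measurable_funB;
    exact: measurableT_comp.
have h0 s : 0 <= h s by rewrite lee_fin sqr_ge0.
have abh s : a s * a s + b s * b s = (a s * b s + a s * b s) + h s.
  rewrite /h /a /b (ffa mu) (ffa nu) -!EFinM -!EFinD /=; congr EFin; ring.
have mab f g : measurable_fun setT f -> measurable_fun setT g ->
  measurable_fun setT (fun s : T => f s * g s : \bar R).
  exact: emeasurable_funM.
have e0 : 0 < (expR v)%:E by rewrite lte_fin expR_gt0.
have ege0 := ltW e0.
have ab0 s : 0 <= a s * b s by exact: mule_ge0.
move=> fin; rewrite -!ge0_muleDr ?integral_ge0//; do ?by move=> s _; exact: mule_ge0.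
rewrite lee_pmul2l//.
have fab : \int[leb]_s (a s * b s) \is a fin_num.
  rewrite ge0_fin_numE ?integral_ge0//.
  rewrite ltNge leye_eq; apply/negP => /eqP ab; move: fin.
  by rewrite ab gt0_muley.
rewrite -[X in X <= _]ge0_integralD//; do ?exact: mab; do ?by move=> s _; exact: mule_ge0.
under eq_integral do rewrite abh.
rewrite ge0_integralD//; last 2 first.
- by move=> s _; exact: adde_ge0.
- by apply: emeasurable_funD; exact: mab.
rewrite ge0_integralD//; last 2 first.
- exact: mab.
- exact: mab.
have fab2 : \int[leb]_s (a s * b s) + \int[leb]_s (a s * b s) \is a fin_num.
  by rewrite (fin_numD (\int[leb]_s (a s * b s))) fab.
rewrite -[leRHS]adde0 (leeD2lE _ _ fab2) => h_le0.
have hE : \int[leb]_s `|h s| = 0.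
  under eq_integral do rewrite gee0_abs//.
  by apply/eqP; rewrite eq_le h_le0 integral_ge0.
have /(ae_eq_integral_abs leb measurableT mh) := hE.
apply: filterS => s /(_ I) [/eqP]; rewrite sqrf_eq0 subr_eq0 => /eqP ab.
by rewrite (ffa mu) (ffa nu); congr EFin.
Qed.

End logplus_energy.

(** * Equality case of positivity for the truncated logarithm *)

Section logplus_strict.
Local Open Scope ereal_scope.
Context {R : realType}.
Local Notation T := (measurableTypeR R).
Local Notation P := (probability T R).
Local Notation leb := (@lebesgue_measure R).
Implicit Types (mu nu : P) (L : R).

Lemma ae_lebesgue_dense (Q : R -> Prop) : {ae leb, forall s, Q s} ->
  forall a b : R, (a < b)%R -> exists2 s, (a < s < b)%R & Q s.
Proof.
move=> [N [mN N0 subN]] a b ab; apply: contrapT => noQ.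
have abN : `]a, b[%classic `<=` N.
  move=> s /=; rewrite in_itv/= => sab; apply: subN => Qs.
  by apply: noQ; exists s.
have mab : measurable (`]a, b[%classic : set T) by exact: measurable_itv.
have : leb `]a, b[%classic = 0 by exact: (@subset_measure0 _ _ _ leb _ _ mab mN abN N0).
rewrite lebesgue_measure_itv/= lte_fin ab => /eqP.
by rewrite -EFinB eqe subr_eq0 gt_eqF.
Qed.

(* The windows have length L, larger than the diameter of the supports: those
   starting to the left of the supports see the measures as rays do. *)
Lemma eq_windows_eq L a mu nu : (0 < a)%R -> (a *+ 2 < L)%R ->
  mu (~` `[(- a)%R, a]%classic) = 0 -> nu (~` `[(- a)%R, a]%classic) = 0 ->
  {ae leb, forall s, mu (window (- ln L) s) = nu (window (- ln L) s)} ->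
  same_measure mu nu.
Proof.
move=> a0 aL mua nua ae_eq; apply: same_measure_rays; apply: rays_dense => c e e0.
have L0 : (0 < L)%R by rewrite (lt_trans _ aL)// pmulrn_lgt0.
(* Starting points in ]c - L, c + e - L[ put the right end s + L just to the right of c. *)
have [s /andP[cs se] munu] := ae_lebesgue_dense ae_eq (a := c - L) (b := c + e - L)
  ltac:(by rewrite ltrD2r ltrDl).
exists (s + L)%R; first by rewrite -ltrBlDr cs -ltrBrDr.
move: munu; rewrite /window opprK lnK// => munu.
have ms : measurable (~` `[(- a)%R, a]%classic : set T).
  by apply: measurableC; exact: measurable_itv.
(* If s < -a, the ray and the window ending at s + L have the same mass. Otherwise s + L >= L - a >
   a, and both rays have mass 1. *)
have [sa|sa] := ltP s (- a)%R.
  have rayE (m : P) : m (~` `[(- a)%R, a]%classic) = 0 ->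
      m `]-oo, (s + L)%R]%classic = m `[s, (s + L)%R]%classic.
    move=> m0; rewrite (_ : `]-oo, (s + L)%R]%classic =
        `]-oo, s[%classic `|` `[s, (s + L)%R]%classic); last first.
      rewrite -itv_bndbnd_setU//= ?bnd_simp//=.
      by rewrite lerDl ltW.
    have mray : measurable (`]-oo, s[%classic : set T) by exact: measurable_itv.
    rewrite setUC measureU0//.
    apply: (@subset_measure0 _ _ _ m _ _ mray ms) m0 => x /=; rewrite !in_itv/= => xs.
    by apply/negP; rewrite negb_and -ltNge (lt_trans xs sa).
  by rewrite !rayE.
have rayE (m : P) : m (~` `[(- a)%R, a]%classic) = 0 ->
    m `]-oo, (s + L)%R]%classic = 1.
  move=> m0; rewrite -[LHS]sube0 -(setCK `]-oo, (s + L)%R]%classic).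
  have mray : measurable (~` `]-oo, (s + L)%R]%classic : set T).
    by apply: measurableC; exact: measurable_itv.
  rewrite sube0 probability_setC// (_ : m _ = 0) ?sube0//.
  apply: (@subset_measure0 _ _ _ m _ _ mray ms) m0.
  move=> x /= /negP; rewrite !in_itv/= -ltNge => sx.
  apply/negP; rewrite negb_and -!ltNge; apply/orP; right.
  rewrite mulr2n in aL; lra.
by rewrite !rayE.
Qed.

(** The part [k1] contributes a nonnegative amount, so the reverse inequality for the sum passes to
    [k2]; finite energies justify the subtraction. It serves twice: to isolate the logarithm in |x -
    t|, and then a single tent within it. *)
Lemma diff_posdefD_cancel d (X : measurableType d) (k1 k2 : X * X -> \bar R)
    (m1 m2 : probability X R) :
  measurable_fun setT k1 -> (forall p, 0 <= k1 p) -> diff_posdef k1 ->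
  measurable_fun setT k2 -> (forall p, 0 <= k2 p) ->
  mutual_energy k2 m1 m2 \is a fin_num ->
  mutual_energy (k1 \+ k2) m1 m1 < +oo -> mutual_energy (k1 \+ k2) m2 m2 < +oo ->
  mutual_energy (k1 \+ k2) m1 m1 + mutual_energy (k1 \+ k2) m2 m2 <=
    mutual_energy (k1 \+ k2) m1 m2 + mutual_energy (k1 \+ k2) m1 m2 ->
  mutual_energy k2 m1 m1 + mutual_energy k2 m2 m2 <=
    mutual_energy k2 m1 m2 + mutual_energy k2 m1 m2.
Proof.
move=> mk1 k10 pk1 mk2 k20; rewrite !mutual_energyD//; have := pk1 m1 m2.
move: (mutual_energy_ge0 m1 m1 k10) (mutual_energy_ge0 m2 m2 k10)
  (mutual_energy_ge0 m1 m2 k10) (mutual_energy_ge0 m1 m1 k20)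
  (mutual_energy_ge0 m2 m2 k20).
move: (mutual_energy k1 m1 m1) (mutual_energy k1 m2 m2) (mutual_energy k1 m1 m2)
  (mutual_energy k2 m1 m1) (mutual_energy k2 m2 m2) (mutual_energy k2 m1 m2).
have fin2 (a b : \bar R) : 0 <= a -> 0 <= b -> a + b < +oo ->
    a \is a fin_num /\ b \is a fin_num.
  move=> a0 b0 ab; rewrite !ge0_fin_numE//.
  by split; apply: le_lt_trans ab; [exact: leeDl|exact: leeDr].
move=> x11 x22 x12 y11 y22 y12 x110 x220 x120 y110 y220 pk y12f.
move=> /(fin2 _ _ x110 y110)[x11f y11f] /(fin2 _ _ x220 y220)[x22f y22f].
have x12f : x12 \is a fin_num.
  have : x12 + x12 < +oo.
    by apply: le_lt_trans pk _; rewrite -(fineK x11f) -(fineK x22f) ltry.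
  by move=> /(fin2 _ _ x120 x120)[].
move: pk; rewrite -(fineK x11f) -(fineK x22f) -(fineK x12f) -(fineK y11f).
rewrite -(fineK y22f) -(fineK y12f) -!EFinD !lee_fin => pk ?; lra.
Qed.

Lemma logplus_energy_eq L a mu nu : (0 < a)%R -> (a *+ 2 < L)%R ->
  mu (~` `[(- a)%R, a]%classic) = 0 -> nu (~` `[(- a)%R, a]%classic) = 0 ->
  mutual_energy (logplus_kernel L) mu mu < +oo ->
  mutual_energy (logplus_kernel L) nu nu < +oo ->
  mutual_energy (logplus_kernel L) mu mu + mutual_energy (logplus_kernel L) nu nu
    <= mutual_energy (logplus_kernel L) mu nu + mutual_energy (logplus_kernel L) mu nu ->
  same_measure mu nu.
Proof.
move=> a0 aL mua nua.
have L0 : (0 < L)%R by rewrite (lt_trans _ aL)// pmulrn_lgt0.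
rewrite logplus_kernelE// => mufin nufin munu.
apply: (eq_windows_eq a0 aL mua nua); apply: tent_energy_eq.
apply: diff_posdefD_cancel mufin nufin munu.
- exact: measurable_integral_tail.
- by move=> p; apply: integral_ge0 => v _; exact: tail_kernel_ge0.
- exact: diff_posdef_tail.
- exact: measurable_tent_kernel.
- exact: tent_kernel_ge0.
- exact: tent_energy_fin.
Qed.

End logplus_strict.

(** * Quantile functions and the uniform measure *)

Section quantile.
Local Open Scope ereal_scope.
Context {R : realType}.
Local Notation T := (measurableTypeR R).
Local Notation P := (probability T R).

Definition unif01 : P := uniform_prob (@ltr01 R).

Lemma unif01_ray (y : R) : (0 <= y <= 1)%R -> unif01 `]-oo, y]%classic = y%:E.
Proof.
move=> /andP[y0 y1]; rewrite /unif01 /= /uniform_prob integral_uniform_pdf.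
rewrite (_ : _ `&` _ = `[0%R, y]%classic); last first.
  apply/seteqP; split => x /=; rewrite !in_itv/=; first by move=> [-> /andP[->]].
  by move=> /andP[-> xy]; split=> //; rewrite (le_trans xy).
rewrite (eq_integral (cst 1)) => [|x]; last first.
  rewrite inE/= in_itv/= /uniform_pdf => /andP[-> xy].
  by rewrite (le_trans xy)//= subr0 invr1.
rewrite integral_cst//= mul1e lebesgue_measure_itv/= lte_fin -EFinB subr0.
by case: ltP => // y0'; congr EFin; apply/le_anti/andP.
Qed.

Lemma ae_unif01 (Q : R -> Prop) : {ae (@lebesgue_measure R), forall s, Q s} ->
  {ae unif01, forall s, Q s}.
Proof.
move=> [N [mN N0 subN]]; exists N; split => //.
by have /null_content_dominatesP := @dominates_uniform_prob R _ _ ltr01; apply.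
Qed.

Section cdf.
Variable mu : P.
Let F (x : R) : R := fine (mu `]-oo, x]%classic).

Lemma ray_nondecreasing (x y : R) : (x <= y)%R -> (F x <= F y)%R.
Proof.
move=> xy; rewrite fine_le ?fin_num_measure// le_measure ?inE//.
by move=> z /=; rewrite !in_itv/= => /le_trans; apply.
Qed.

Lemma ray_right_continuous (x s : R) :
  (forall y, (x < y)%R -> (s <= F y)%R) -> (s <= F x)%R.
Proof.
move=> sF.
pose X : {mfun T >-> R} := HB.pack (idfun : T -> R)
  (@isMeasurableFun.Build _ _ T R (idfun : T -> R) (@measurable_id _ _ setT)).
rewrite -lee_fin fineK ?fin_num_measure//.
apply: (cvge_ge _ (@cdf_right_continuous _ _ _ mu X x)).
near=> y; have xy : (x < y)%R by near: y; exact: nbhs_right_gt.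
by rewrite /cdf -(fineK (fin_num_measure mu _ _))// lee_fin; exact: sF.
Unshelve. all: by end_near. Qed.

(* The clause x = a makes the set nonempty, so that the value is in [-a, a]
   for every s, also outside [0, 1]. *)
Definition quantile (a s : R) : R :=
  inf [set x | (-a <= x <= a)%R /\ ((s <= F x)%R \/ x = a)].

Variable a : R.
Hypothesis a0 : (0 < a)%R.
Hypothesis mua : mu (~` `[(- a)%R, a]%classic) = 0.

Let Q s := [set x | (-a <= x <= a)%R /\ ((s <= F x)%R \/ x = a)].

Let Qa s : Q s a.
Proof. by split; [rewrite lexx andbT (le_trans _ (ltW a0))// oppr_le0 ltW|right]. Qed.

Let Qlb s : lbound (Q s) (- a)%R.
Proof. by move=> x [/andP[]]. Qed.

Let Qinf s : has_inf (Q s).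
Proof. by split; [exists a|exists (- a)%R]. Qed.

Lemma quantile_itv s : (- a <= quantile a s <= a)%R.
Proof.
apply/andP; split.
  by apply: lb_le_inf; [exists a; exact: Qa|exact: Qlb].
by apply: ge_inf; [exists (- a)%R; exact: Qlb|exact: Qa].
Qed.

Lemma quantile_nondecreasing : {homo quantile a : s t / (s <= t)%R}.
Proof.
move=> s t st; apply: lb_le_inf; first by exists a; exact: Qa.
move=> x [xa tF]; apply: ge_inf; first by exists (- a)%R; exact: Qlb.
by split => //; case: tF => [tF|]; [left; exact: le_trans tF|right].
Qed.

(** Right continuity of the distribution function makes the infimum effective: s <= F y for all y >
    x gives s <= F x. The bound x < a keeps the conventional element a of the set out of the way. *)
Lemma quantile_le s x : (- a <= x < a)%R -> (quantile a s <= x)%R = (s <= F x)%R.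
Proof.
move=> /andP[ax xa]; apply/idP/idP => [qx|sF]; last first.
  apply: ge_inf; first by exists (- a)%R; exact: Qlb.
  by split; [rewrite ax ltW|left].
apply: ray_right_continuous => y xy.
have qy : (quantile a s < Num.min y a)%R by rewrite lt_min !(le_lt_trans qx).
have [z [/andP[az za] [sFz|->]]] := inf_lt (Qinf s).1 qy; last first.
  by rewrite lt_min ltxx andbF.
by rewrite lt_min => /andP[zy _]; rewrite (le_trans sFz)// ray_nondecreasing// ltW.
Qed.

Lemma measurable_quantile : measurable_fun setT (quantile a : T -> T).
Proof.
have := @nondecreasing_measurable R setT (quantile a) measurableT.
by apply => s t; exact: quantile_nondecreasing.
Qed.

(** The quantile transform, checked on rays: between -a and a, [quantile_le] turns the preimage into
    a ray of the uniform measure; elsewhere both masses are 0 or 1. All measures thus become laws on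
    one space, where almost everywhere convergence makes sense. *)
Lemma quantileE (A : set T) : measurable A -> mu A = unif01 (quantile a @^-1` A).
Proof.
pose q : {mfun T >-> T} := HB.pack (quantile a : T -> T)
  (isMeasurableFun.Build _ _ _ _ _ measurable_quantile).
have ms : measurable (~` `[(- a)%R, a]%classic : set T).
  by apply: measurableC; exact: measurable_itv.
apply: (@same_measure_rays _ mu (distribution unif01 q)) => x.
rewrite /= /pushforward.
have [xa|ax] := ltP x (- a)%R.
  rewrite (_ : _ @^-1` _ = set0) ?measure0.
    have mray : measurable (`]-oo, x]%classic : set T) by exact: measurable_itv.
    apply: (@subset_measure0 _ _ _ mu _ _ mray ms) mua => z /=.
    rewrite !in_itv/= => zx; apply/negP; rewrite negb_and -ltNge.
    by rewrite (le_lt_trans zx xa).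
  apply/seteqP; split => // s /=; rewrite in_itv/=; apply/negP; rewrite -ltNge.
  by have /andP[+ _] := quantile_itv s; exact: lt_le_trans.
have [xa|ax'] := ltP x a; last first.
  have -> : quantile a @^-1` `]-oo, x]%classic = setT.
    apply/seteqP; split => // s _ /=; rewrite in_itv/=.
    by have /andP[_ sa] := quantile_itv s; exact: le_trans ax'.
  rewrite [RHS]probability_setT -[LHS]sube0 -(setCK `]-oo, x]%classic).
  have mray : measurable (~` `]-oo, x]%classic : set T).
    by apply: measurableC; exact: measurable_itv.
  rewrite sube0 probability_setC// (_ : mu _ = 0) ?sube0//.
  apply: (@subset_measure0 _ _ _ mu _ _ mray ms) mua.
  move=> z /= /negP; rewrite !in_itv/= -ltNge => zx.
  by apply/negP; rewrite negb_and -!ltNge (le_lt_trans ax' zx) orbT.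
have -> : quantile a @^-1` `]-oo, x]%classic = `]-oo, F x]%classic.
  apply/seteqP; split => s /=; rewrite !in_itv/= quantile_le ?ax//.
rewrite unif01_ray ?fineK ?fin_num_measure//.
by rewrite fine_ge0//= -lee_fin fineK ?fin_num_measure// probability_le1.
Qed.

End cdf.
End quantile.

(** * Helly selection for bounded nondecreasing functions *)

Section helly.
Context {R : realType}.
Variables (a : R) (q : nat -> R -> R).
Hypothesis q_itv : forall n s, - a <= q n s <= a.
Hypothesis q_nd : forall n, {homo q n : s t / s <= t}.

(** Tychonoff on the product of copies of [-a, a] indexed by the rationals gives a cluster point G.
    The k-th index is chosen within 1/(k+1) of G at the rationals with code below k, a condition on
    finitely many coordinates and hence a neighbourhood. The bound k <= phi k replaces strict
    monotonicity: it already sends phi to infinity. *)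
Lemma cvg_subseq_rat : exists (phi : nat -> nat) (G : rat -> R),
  (forall k, (k <= phi k)%N) /\
  forall r, q (phi k) (ratr r) @[k --> \oo] --> G r.
Proof.
pose Y := forall i : rat, (fun _ : rat => R) i.
pose h (n : nat) : Y := fun r => q n (ratr r).
have /(_ (h @ \oo)) := @tychonoff rat (fun=> R) (fun=> `[(- a)%R, a]%classic)
  (fun=> @segment_compact R _ _).
case => [|G [_ clG]].
  by exists 0%N => // n _ /= r; rewrite in_itv/=; exact: q_itv.
have nbhsG m e : 0 < e -> nbhs G
    [set f : Y | forall r : rat, (pickle r < m)%N -> `|f r - G r| < e].
  move=> e0; elim: m => [|m IH]; first by apply: filterS filterT.
  have ev : nbhs G [set f : Y | forall r : rat, pickle r = m -> `|f r - G r| < e].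
    case mr : (unpickle m : option rat) => [r|]; last first.
      by apply: filterS filterT => f _ r rm; move: mr; rewrite -rm pickleK.
    have ball_r : nbhs G (fun f : Y => ball (G r) e (f r)) :=
      @proj_continuous rat (fun=> R) r G (ball (G r) e) (nbhsx_ballx _ _ e0).
    apply: (filterS _ ball_r) => f fr r' rm.
    have -> : r' = r by apply/Some_inj; rewrite -mr -rm pickleK.
    by move: fr; rewrite /ball/= distrC.
  apply: filterS2 IH ev => f f1 f2 r; rewrite ltnS leq_eqVlt => /orP[/eqP|].
    exact: f2.
  exact: f1.
have /choice[phi phiP] : forall k : nat, exists n, (k <= n)%N /\
    forall r : rat, (pickle r < k)%N -> `|q n (ratr r) - G r| < k.+1%:R^-1.
  move=> k; have e0 : 0 < (k.+1%:R^-1 : R) by rewrite invr_gt0.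
  have hk : (h @ \oo) [set h n | n in [set n | (k <= n)%N]].
    by exists k => // n kn; exists n.
  have [_ [[n kn <-] hn]] := clG _ _ hk (nbhsG k _ e0).
  by exists n.
exists phi, G; split => [k|r]; first by have [] := phiP k.
apply/cvgrPdist_lt => e e0; near=> k; rewrite distrC.
have [_ /(_ r)] := phiP k.
have -> : (pickle r < k)%N by near: k; exact: nbhs_infty_gt.
move=> /(_ isT) /lt_le_trans; apply.
rewrite ltW//; near: k; exact: near_infty_natSinv_lt (PosNum e0).
Unshelve. all: by end_near. Qed.

(** With g and g' the left and right limits of G along the rationals, monotonicity squeezes
    [q (phi k) s] between its values at two rationals on either side of s, unless s is a jump, g s <
    g' s. *)
Lemma helly : exists (phi : nat -> nat) (g : R -> R),
  [/\ forall k, (k <= phi k)%N, {homo g : s t / s <= t} &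
    {ae (@lebesgue_measure R), forall s, q (phi k) s @[k --> \oo] --> g s}].
Proof.
have [phi [G [phik qG]]] := cvg_subseq_rat.
have G_itv r : - a <= G r <= a.
  apply/andP; split; [apply: (cvgr_to_ge (qG r))|apply: (cvgr_to_le (qG r))];
  by apply: nearW => k; have /andP[] := q_itv (phi k) (ratr r).
have G_nd r r' : (r <= r')%O -> G r <= G r'.
  move=> rr'; apply: (ler_cvg_to (qG r) (qG r')).
  by apply: nearW => k; apply: q_nd; rewrite ler_rat.
have [rat_lt rat_gt] : (forall s : R, exists r, ratr r < s) /\
    (forall s : R, exists r, s < ratr r).
  split=> s.
    by have [|r] := @rat_in_itvoo R (s - 1) s; [lra|move=> /andP[_ ?]; exists r].
  by have [|r] := @rat_in_itvoo R s (s + 1); [lra|move=> /andP[? _]; exists r].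
pose lo (s : R) := [set G r | r in [set r | ratr r < s]].
pose hi (s : R) := [set G r | r in [set r | s < ratr r]].
have lo0 s : lo s !=set0 by have [r rs] := rat_lt s; exists (G r), r.
have hi0 s : hi s !=set0 by have [r rs] := rat_gt s; exists (G r), r.
have loub s : has_ubound (lo s).
  by exists a => _ [r _ <-]; have /andP[] := G_itv r.
have hilb s : has_lbound (hi s).
  by exists (- a) => _ [r _ <-]; have /andP[] := G_itv r.
pose g s := sup (lo s); pose g' s := inf (hi s).
have g'g s t : s < t -> g' s <= g t.
  move=> st; have [r /andP[sr rt]] := @rat_in_itvoo R s t st.
  apply: (@le_trans _ _ (G r)).
    by apply: ge_inf => //; exists r.
  by apply: ub_le_sup => //; exists r.
exists phi, g; split => //.
  move=> s t st; apply: ge_sup => // _ [r rs <-].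
  by apply: ub_le_sup => //; exists r => //=; exact: lt_le_trans rs st.
(* For s < t one has g' s <= g t, so the gaps ]g s, g' s[ are disjoint, and a rational chosen in
   each injects the jumps into a countable type. *)
have cD : countable [set s | g s < g' s].
  have /choice[rho rhoP] : forall s, exists r : rat, g s < g' s -> g s < ratr r < g' s.
    move=> s; have [gs|_] := ltP (g s) (g' s); last by exists 0.
    by have [r rP] := @rat_in_itvoo R _ _ gs; exists r.
  apply/countable_injP; exists (fun s => pickle (rho s)) => s t.
  rewrite !inE/= => sD tD /(pcan_inj pickleK) rst.
  have := rhoP _ sD; have := rhoP _ tD; rewrite -rst => /andP[t1 t2] /andP[s1 s2].
  case: (ltgtP s t) => // st.
    by have := lt_trans s2 (le_lt_trans (g'g _ _ st) t1); rewrite ltxx.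
  by have := lt_trans t2 (le_lt_trans (g'g _ _ st) s1); rewrite ltxx.
exists [set s | g s < g' s]; split.
- exact: countable_measurable.
- exact: countable_lebesgue_measure0.
move=> s /= ncvg; rewrite ltNge; apply/negP => g'gs; apply: ncvg.
apply/cvgrPdist_le => e e0.
have e20 : 0 < e / 2 by lra.
have [_ [r1 /= r1s <-] Gr1] := sup_adherent e20 (conj (lo0 s) (loub s)).
have [_ [r2 /= r2s <-] Gr2] := inf_adherent e20 (conj (hi0 s) (hilb s)).
have /cvgrPdist_le/(_ _ e20) n1 := qG r1.
have /cvgrPdist_le/(_ _ e20) n2 := qG r2.
near=> k.
have /ler_normlP[] : `|G r1 - q (phi k) (ratr r1)| <= e / 2 by near: k.
have /ler_normlP[] : `|G r2 - q (phi k) (ratr r2)| <= e / 2 by near: k.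
have := q_nd (phi k) (ltW r1s); have := q_nd (phi k) (ltW r2s).
rewrite -/(g s) in Gr1; rewrite -/(g' s) in Gr2.
move=> *; apply/ler_normlP; split; lra.
Unshelve. all: by end_near. Qed.

End helly.

(** * Lower limits of integrals *)

Section fatou_ae.
Local Open Scope ereal_scope.
Context d (X : measurableType d) {R : realType} (m : {measure set X -> \bar R}).

Lemma fatou_ae (f_ : nat -> X -> \bar R) (f : X -> \bar R) :
  (forall n, measurable_fun setT (f_ n)) -> (forall n x, 0 <= f_ n x) ->
  measurable_fun setT f -> (forall x, 0 <= f x) ->
  {ae m, forall x, f x <= limn_einf (f_ ^~ x)} ->
  \int[m]_x f x <= limn_einf (fun n => \int[m]_x f_ n x).
Proof.
move=> mf_ f_0 mf f0 ff_; apply: le_trans (fatou _ _ _ _) => //.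
apply: ae_ge0_le_integral => //.
- move=> x _; rewrite limn_einf_lim; apply: lime_ge; first exact: is_cvg_einfs.
  by apply: nearW => n; apply: le_ereal_inf_tmp => _ [k _ <-].
- apply: measurableT_comp => //; apply: measurable_fun_limn_esup => n.
  exact: measurableT_comp.
- by apply: filterS ff_ => x + _.
Qed.

End fatou_ae.

Lemma limn_einf_le (R : realType) (u v : nat -> \bar R) (l : \bar R) :
  (forall n, (u n <= v n)%E) -> v n @[n --> \oo] --> l -> (limn_einf u <= l)%E.
Proof.
move=> uv vl; rewrite -(cvg_limn_einf_sup vl).1 !limn_einf_lim.
apply: lee_lim; [exact: is_cvg_einfs|exact: is_cvg_einfs|].
apply: nearW => n; apply: le_ereal_inf_tmp => _ [k /= nk <-].
by apply: le_trans (uv k); apply: ereal_inf_lbound; exists k.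
Qed.

(** * Existence of a minimizer of the energy *)

Section existence.
Local Open Scope ereal_scope.
Context {R : realType}.
Local Notation T := (measurableTypeR R).
Local Notation P := (probability T R).
Variable k : T * T -> \bar R.
Hypothesis mk : measurable_fun setT k.
Hypothesis k0 : forall p, 0 <= k p.
Hypothesis k_cvg : forall (u v : nat -> R) (x y : R),
  u n @[n --> \oo] --> x -> v n @[n --> \oo] --> y ->
  k (u n, v n) @[n --> \oo] --> k (x, y).

Lemma mutual_energy_same (mu mu' nu nu' : P) :
  same_measure mu mu' -> same_measure nu nu' ->
  mutual_energy k mu nu = mutual_energy k mu' nu'.
Proof.
move=> mumu' nunu'; rewrite /mutual_energy (eq_measure_integral mu').
  apply: eq_integral => x _; rewrite (eq_measure_integral nu')//.
  by move=> A mA _; exact: nunu'.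
by move=> A mA _; exact: mumu'.
Qed.

Variables (F : set R) (a : R).
Hypothesis cF : closed F.
Hypothesis a0 : (0 < a)%R.
Hypothesis Fa : F `<=` `[(- a)%R, a]%classic.

Let mF : measurable (F : set T).
Proof. exact: closed_measurable. Qed.

Lemma M1_itv (mu : P) : M1 F mu -> mu (~` `[(- a)%R, a]%classic) = 0.
Proof.
move=> muF; have mI : measurable (~` `[(- a)%R, a]%classic : set T).
  by apply: measurableC; exact: measurable_itv.
apply: (@subset_measure0 _ _ _ mu _ _ mI (measurableC mF)) muF.
exact: subsetC.
Qed.

(** The limit is the law of the almost everywhere limit g of the quantile functions: it is
    concentrated on F because F is closed, and Fatou's lemma in each variable bounds its energy. As
    the selected indices need not increase, v has to converge along every phi with i <= phi i. *)
Lemma limit_measure (nu : nat -> P) (v : nat -> \bar R) (l : \bar R) :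
  (forall n, M1 F (nu n)) ->
  (forall n, mutual_energy k (nu n) (nu n) <= v n) ->
  (forall phi : nat -> nat, (forall i, (i <= phi i)%N) ->
     v (phi n) @[n --> \oo] --> l) ->
  exists2 lambda : P, M1 F lambda & mutual_energy k lambda lambda <= l.
Proof.
move=> nuF nuv vl; pose q n := quantile (nu n) a.
have nua n := M1_itv (nuF n).
have [phi [g [phiP g_nd qg]]] := @helly R a q
  (fun n => quantile_itv (nu n) a0) (fun n => quantile_nondecreasing (nu n) a0).
have mg : measurable_fun setT (g : T -> T).
  by have := @nondecreasing_measurable R setT g measurableT; apply.
have mq n : measurable_fun setT (q n : T -> T).
  exact: measurable_quantile.
pose gm : {mfun T >-> T} := HB.pack (g : T -> T) (isMeasurableFun.Build _ _ _ _ _ mg).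
pose qm n : {mfun T >-> T} := HB.pack (q n : T -> T)
  (isMeasurableFun.Build _ _ _ _ _ (mq n)).
have {}qg := ae_unif01 qg.
have qF n : {ae unif01, forall s, F (q n s)}.
  exists (q n @^-1` (~` F)); split => //.
    by have := mq n measurableT _ (measurableC mF); rewrite setTI.
  by rewrite -(quantileE a0 (nua n) (measurableC mF)); exact: nuF.
have aeF : Filter (almost_everywhere (@unif01 R)) :=
  ae_filter_ringOfSetsType unif01.
have aeF' : Filter (nbhs (almost_everywhere (@unif01 R))) := aeF.
have gF : {ae unif01, forall s, F (g s)}.
  apply: filterS2 qg (ae_foralln qF) => s qgs qFs.
  by apply: (closed_cvg _ cF _ _ qgs); apply: nearW => n; exact: qFs.
exists (distribution unif01 gm).
  have mgF : measurable (g @^-1` (~` F)).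
    by have := mg measurableT _ (measurableC mF); rewrite setTI.
  have gF0 : unif01 (g @^-1` (~` F)) = 0.
    by apply: measure_negligible.
  exact: gF0.
have nuE n : mutual_energy k (nu n) (nu n) =
    \int[unif01]_s \int[unif01]_t k (q n s, q n t).
  rewrite (@mutual_energy_same _ (distribution unif01 (qm n)) _
    (distribution unif01 (qm n)));
    try by move=> A mA; rewrite (quantileE a0 (nua n)).
  by rewrite -(@mutual_energy_comp _ _ _ k (q n) _ _ unif01 unif01).
rewrite -(@mutual_energy_comp _ _ _ k g _ _ unif01 unif01)// /mutual_energy/=.
have mk2 (f h : T -> T) : measurable_fun setT f -> measurable_fun setT h ->
    measurable_fun setT (fun p : T * T => k (f p.1, h p.2)).
  move=> mf mh; apply: (measurableT_comp mk (g := fun p => (f p.1, h p.2))).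
  by apply: measurable_fun_pair; exact: measurableT_comp.
have mint (f : T -> T) : measurable_fun setT f ->
    measurable_fun setT (fun s => \int[unif01]_t k (f s, f t)).
  move=> mf.
  by apply: (measurable_fun_fubini_tonelli_F (m2 := unif01)
    (fun p : T * T => k (f p.1, f p.2))) => //; exact: mk2.
have mint1 (f : T -> T) s : measurable_fun setT f ->
    measurable_fun setT (fun t => k (f s, f t)).
  move=> mf; apply: (measurableT_comp mk (g := fun t => (f s, f t))).
  exact: measurable_fun_pair.
apply: le_trans (limn_einf_le (fun n => nuv (phi n)) (vl phi phiP)).
have fE : (fun n => mutual_energy k (nu (phi n)) (nu (phi n))) =
    (fun n => \int[unif01]_s \int[unif01]_t k (q (phi n) s, q (phi n) t)).
  by apply/funext => n; rewrite nuE.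
rewrite fE.
apply: (fatou_ae (m := unif01) (f_ := fun n s => \int[unif01]_t k (q (phi n) s, q (phi n) t))).
- by move=> n; exact: mint.
- by move=> n s; apply: integral_ge0.
- exact: mint.
- by move=> s; apply: integral_ge0.
apply: filterS (qg) => s qgs.
apply: (fatou_ae (m := unif01) (f_ := fun n t => k (q (phi n) s, q (phi n) t))) => //.
- by move=> n; exact: mint1.
- exact: mint1.
apply: filterS (qg) => t qgt.
by rewrite (cvg_limn_einf_sup (k_cvg qgs qgt)).1.
Qed.

Lemma energy_minimizer :
  (exists2 nu : P, M1 F nu & mutual_energy k nu nu < +oo) ->
  exists2 lambda : P, M1 F lambda &
  forall nu, M1 F nu -> mutual_energy k lambda lambda <= mutual_energy k nu nu.
Proof.
move=> [nu0 nu0F nu0fin].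
pose S := [set mutual_energy k nu nu | nu in M1 F].
have S0 e : S e -> 0 <= e by move=> [nu _ <-]; exact: mutual_energy_ge0.
have Sinf nu : M1 F nu -> ereal_inf S <= mutual_energy k nu nu.
  by move=> nuF; apply: ereal_inf_lbound; exists nu.
have inff : ereal_inf S \is a fin_num.
  rewrite ge0_fin_numE; last exact: le_ereal_inf_tmp.
  by apply: le_lt_trans nu0fin; exact: Sinf.
have /choice[nu nuP] : forall n : nat, exists nu : P, M1 F nu /\
    mutual_energy k nu nu <= ereal_inf S + (n.+1%:R^-1)%:E.
  move=> n; have n0 : (0 < (n.+1%:R^-1 : R))%R by rewrite invr_gt0.
  by have [_ [nu nuF <-] /ltW] := lb_ereal_inf_adherent n0 inff; exists nu.
have v_lim (phi : nat -> nat) : (forall i, (i <= phi i)%N) ->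
    ereal_inf S + ((phi n).+1%:R^-1)%:E @[n --> \oo] --> ereal_inf S.
  move=> phiP; rewrite -[X in _ --> X]adde0.
  apply: cvgeD; [by rewrite fin_num_adde_defl|exact: cvg_cst|].
  apply: cvg_EFin; first by apply: nearW.
  apply: (@squeeze_cvgr _ _ _ _ (fun=> 0%R) (fun n => n.+1%:R^-1)%R).
  - apply: nearW => n; rewrite /= invr_ge0 ler0n/= lef_pV2 ?posrE//.
    by rewrite ler_nat ltnS.
  - exact: cvg_cst.
  - exact: cvg_harmonic.
have [lambda lF lE] := limit_measure (fun n => (nuP n).1) (fun n => (nuP n).2) v_lim.
by exists lambda => // nu' nu'F; exact: le_trans lE (Sinf _ nu'F).
Qed.

End existence.

(** * Convex combinations and the first variation *)

Section mixture.
Local Open Scope ereal_scope.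
Context d (X : measurableType d) {R : realType}.
Local Notation P := (probability X R).

Lemma mixture (mu nu : P) (t : R) : (0 <= t <= 1)%R ->
  exists2 m : P,
    forall A, m A = (1 - t)%:E * mu A + t%:E * nu A &
    forall f : X -> \bar R, measurable_fun setT f -> (forall x, 0 <= f x) ->
      \int[m]_x f x = (1 - t)%:E * \int[mu]_x f x + t%:E * \int[nu]_x f x.
Proof.
move=> /andP[t0 t1].
have t1' : (0 <= 1 - t)%R by rewrite subr_ge0.
pose m0 : {measure set X -> \bar R} := measure_add (mscale (NngNum t1') mu) (mscale (NngNum t0) nu).
have m0E A : m0 A = (1 - t)%:E * mu A + t%:E * nu A.
  exact: measure_addE.
have m0T : m0 setT = 1.
  by rewrite m0E !probability_setT !mule1 -EFinD subrK.
(* The total mass is already 1, so normalizing changes only the type; [mu] is the default value for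
   a degenerate mass. *)
pose m : P := mnormalize m0 mu.
have mE A : m A = m0 A.
  by rewrite -[LHS]/(mnormalize m0 mu A) /mnormalize m0T onee_eq0/= invr1 mule1.
exists m => [A|f mf f0]; first by rewrite mE.
rewrite (eq_measure_integral m0); last by move=> A _ _; exact: mE.
by rewrite ge0_integral_measure_add// !ge0_integral_mscale.
Qed.

End mixture.

Section variation.
Local Open Scope ereal_scope.
Context {R : realType}.
Local Notation T := (measurableTypeR R).
Local Notation P := (probability T R).
Variable k : T * T -> \bar R.
Hypothesis mk : measurable_fun setT k.
Hypothesis k0 : forall p, 0 <= k p.
Hypothesis k_sym : forall x y, k (x, y) = k (y, x).
Hypothesis k_pos : diff_posdef k.
Implicit Types mu nu : P.

Local Notation E := (mutual_energy k).

(** Positivity acts as a Cauchy-Schwarz inequality: 2 E(mu, nu) is at most the sum of two finite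
    energies. *)
Lemma mutual_energy_fin mu nu : E mu mu < +oo -> E nu nu < +oo ->
  E mu nu \is a fin_num.
Proof.
move=> mufin nufin; rewrite ge0_fin_numE ?mutual_energy_ge0//.
apply: (@le_lt_trans _ _ (E mu nu + E mu nu)).
  by rewrite leeDl// mutual_energy_ge0.
by apply: le_lt_trans (k_pos mu nu) _; exact: lte_add_pinfty.
Qed.

(** Along (1 - t) lambda + t nu the energy is a quadratic polynomial in t, minimal at t = 0; its
    derivative there, 2 (E(lambda, nu) - E(lambda, lambda)), cannot be negative. *)
Lemma first_variation (F : set R) (lambda nu : P) : M1 F lambda ->
  (forall mu, M1 F mu -> E lambda lambda <= E mu mu) ->
  M1 F nu -> E nu nu < +oo -> E lambda lambda <= E lambda nu.
Proof.
move=> lF lmin nuF nufin.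
have lfin : E lambda lambda < +oo by apply: le_lt_trans (lmin nu nuF) nufin.
have fin mu1 mu2 := @mutual_energy_fin mu1 mu2.
have mix t : (0 <= t <= 1)%R -> E lambda lambda <=
    (1 - t)%:E * ((1 - t)%:E * E lambda lambda + t%:E * E lambda nu) +
    t%:E * ((1 - t)%:E * E lambda nu + t%:E * E nu nu).
  move=> t01; have [m mE mint] := mixture lambda nu t01.
  have intm (m' : P) : E m m' = (1 - t)%:E * E lambda m' + t%:E * E nu m'.
    rewrite {1}/mutual_energy mint//; last by move=> x; apply: integral_ge0.
    exact: measurable_fun_fubini_tonelli_F.
  have -> : (1 - t)%:E * ((1 - t)%:E * E lambda lambda + t%:E * E lambda nu) +
      t%:E * ((1 - t)%:E * E lambda nu + t%:E * E nu nu) = E m m.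
    rewrite intm (mutual_energyC lambda m)// (mutual_energyC nu m)//.
    by rewrite !intm (mutual_energyC nu lambda).
  apply: lmin; rewrite /M1/= mE (_ : lambda _ = 0) ?mule0 ?add0e//.
  by rewrite (_ : nu _ = 0) ?mule0.
have := k_pos lambda nu; move: mix.
have := fin _ _ lfin lfin; have := fin _ _ lfin nufin; have := fin _ _ nufin nufin.
move: (E lambda lambda) (E lambda nu) (E nu nu) => [a| |] [b| |] [c| |]// _ _ _.
move=> mix; rewrite -!EFinD !lee_fin => bac.
rewrite leNgt; apply/negP => ba.
(* Minimality, divided by t, reads 2 (a - b) <= t (a + c - 2 b). The denominator D exceeds both a -
   b and the curvature a + c - 2 b, so t is at most 1 and t (a + c - 2 b) <= t D = a - b, which
   contradicts b < a. *)
pose t : R := ((a - b) / ((a - b) + (a + c - (b + b)) + 1))%R.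
set D : R := (a - b + (a + c - (b + b)) + 1)%R in t.
have D0 : (0 < D)%R by rewrite /D; lra.
have tD : (t * D = a - b)%R by rewrite /t mulfVK// gt_eqF.
have t0 : (0 < t)%R by rewrite divr_gt0//; lra.
have t1 : (t <= 1)%R by rewrite ler_pdivrMr// mul1r /D; lra.
have := mix t; rewrite (ltW t0) t1 -!(EFinM, EFinD) lee_fin => /(_ isT) mixt.
have : (t * (2 * (a - b)) <= t * (t * (a + c - (b + b))))%R by lra.
rewrite ler_pM2l// => le2.
have : (t * (a + c - (b + b)) <= t * D)%R by rewrite ler_pM2l// /D; lra.
rewrite tD; lra.
Qed.

End variation.

(** * The support of a measure *)

Section support.
Local Open Scope ereal_scope.
Context {R : realType}.
Local Notation T := (measurableTypeR R).
Local Notation P := (probability T R).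
Implicit Types mu nu : P.

Lemma msupport_closed mu : closed (msupport mu).
Proof.
rewrite -[msupport mu]setCK; apply: open_closedC; rewrite openE => x /= xS.
have [U [oU Ux muU]] : exists U, [/\ open U, U x & ~ (0 < mu U)].
  apply: contrapT => noU; apply: xS => U oU Ux; apply: contrapT => muU.
  by apply: noU; exists U.
rewrite /interior nbhsE; exists U => // y Uy yS; apply: muU.
exact: yS.
Qed.

Lemma msupport_sub (F : set R) mu : closed F -> M1 F mu -> msupport mu `<=` F.
Proof.
move=> cF muF x Sx; apply: contrapT => nFx.
by have := Sx (~` F) (closed_openC cF) nFx; rewrite muF ltxx.
Qed.

(** Every point off the support lies in a null interval with rational endpoints, and there are
    countably many of these; [I] enumerates them through the codes of pairs of rationals. *)
Lemma msupportC mu : mu (~` msupport mu) = 0.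
Proof.
pose I (n : nat) : set T :=
  if (unpickle n : option (rat * rat)) is Some r then
    if mu `]ratr r.1, ratr r.2[%classic == 0 then `]ratr r.1, ratr r.2[%classic
    else set0
  else set0.
have I0 n : mu.-negligible (I n).
  rewrite /I; case: unpickle => [r|]; last exact: negligible_set0.
  case: ifPn => [/eqP r0|_]; last exact: negligible_set0.
  by apply/negligibleP => //; exact: measurable_itv.
have mS : measurable (~` msupport mu : set T).
  by apply: measurableC; exact: closed_measurable (@msupport_closed mu).
apply: (measure_negligible mS); apply: negligibleS (negligible_bigcup I0).
move=> x /= xS.
have [U [oU Ux muU]] : exists U, [/\ open U, U x & ~ (0 < mu U)].
  apply: contrapT => noU; apply: xS => U oU Ux; apply: contrapT => muU.
  by apply: noU; exists U.
have /nbhs_ballP[e /= e0 xeU] : nbhs x U by exact: open_nbhs_nbhs.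
have [|r1] := @rat_in_itvoo R (x - e) x; first by rewrite ltrBlDr ltrDl.
rewrite in_itv/= => /andP[r1l r1r].
have [|r2] := @rat_in_itvoo R x (x + e); first by rewrite ltrDl.
rewrite in_itv/= => /andP[r2l r2r].
have := pickleK (r1, r2); move: (pickle (r1, r2)) => n nE.
exists n => //; rewrite /I nE/= ifT; first by rewrite /= in_itv/= r1r r2l.
rewrite -measure_le0; apply: (@le_trans _ _ (mu U)).
  rewrite le_measure ?inE//; first exact: open_measurable.
  move=> y /=; rewrite in_itv/= => /andP[r1y yr2]; apply: xeU.
  by rewrite /ball/= ltr_distlC; apply/andP; split; lra.
by rewrite leNgt; exact/negP.
Qed.

End support.

(** * The equilibrium condition for a continuous nonnegative kernel *)

Section equilibrium_characterization.
Local Open Scope ereal_scope.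
Context {R : realType}.
Local Notation T := (measurableTypeR R).
Local Notation P := (probability T R).
Variable k : T * T -> \bar R.
Hypothesis mk : measurable_fun setT k.
Hypothesis k0 : forall p, 0 <= k p.
Hypothesis k_cvg : forall (u v : nat -> R) (x y : R),
  u n @[n --> \oo] --> x -> v n @[n --> \oo] --> y ->
  k (u n, v n) @[n --> \oo] --> k (x, y).
Variable F : set R.
Hypothesis cF : closed F.
Implicit Types mu nu : P.

Local Notation E := (mutual_energy k).
Local Notation U := (fun mu x => \int[mu]_y k (x, y)).

Let mU mu : measurable_fun setT (U mu : T -> \bar R).
Proof. exact: measurable_fun_fubini_tonelli_F. Qed.

Let U0 mu x : 0 <= U mu x.
Proof. exact: integral_ge0. Qed.

Lemma ae_M1 mu (Q : R -> Prop) : M1 F mu -> (forall x, F x -> Q x) ->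
  {ae mu, forall x, Q x}.
Proof.
move=> muF FQ; exists (~` F); split => //.
  by apply: measurableC; exact: closed_measurable.
by move=> x /= nQ Fx; apply: nQ; exact: FQ.
Qed.

(** The potential of mu integrates to at most w against mu, which charges only its support, and to
    at least w against nu, which charges only F. *)
Lemma equilibrium_energy mu (w : \bar R) : M1 F mu ->
  (forall x, msupport mu x -> U mu x = w) ->
  (forall x, (F `\` msupport mu) x -> w <= U mu x) ->
  forall nu, M1 F nu -> E mu mu <= E nu mu.
Proof.
move=> muF Sw Fw nu nuF.
have w0 : 0 <= w.
  have [x Sx] : msupport mu !=set0.
    apply/set0P/negP => /eqP S0; have := msupportC mu.
    rewrite S0 setC0 probability_setT => /eqP.
    by rewrite onee_eq0.
  by rewrite -(Sw x Sx).
apply: (@le_trans _ _ w).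
  rewrite -[leRHS](integral_prob_cst mu); apply: ae_ge0_le_integral => //.
  exists (~` msupport mu); split.
  - by apply: measurableC; exact: closed_measurable (@msupport_closed _ mu).
  - exact: msupportC.
  - by move=> x /= nle Sx; apply: nle => _; rewrite (Sw x Sx).
rewrite -[leLHS](integral_prob_cst nu); apply: ae_ge0_le_integral => //.
have := @ae_M1 nu (fun x => w <= U mu x) nuF.
have FU x : F x -> w <= U mu x.
  have [Sx _|nSx Fx] := pselect (msupport mu x); first by rewrite (Sw x Sx).
  exact: Fw.
move=> /(_ FU) [N [mN N0 NU]]; exists N; split => // x /= nle; apply: NU => /= le.
exact: nle.
Qed.

(** Otherwise a sequence tends to x0 with potentials at most c, and Fatou's lemma with the
    continuity of k into the extended reals gives U mu x0 <= c. *)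
Lemma potential_lsc mu (c : R) (x0 : R) : c%:E < U mu x0 ->
  exists2 e : R, (0 < e)%R & forall x, (`|x0 - x| < e)%R -> c%:E < U mu x.
Proof.
move=> cU; apply: contrapT => noe.
have /choice[u uP] : forall n : nat, exists x : R,
    (`|x0 - x| < n.+1%:R^-1)%R /\ U mu x <= c%:E.
  move=> n; apply: contrapT => nox; apply: noe; exists (n.+1%:R^-1)%R.
    by rewrite invr_gt0.
  move=> x xn; rewrite ltNge; apply/negP => Uc; apply: nox.
  by exists x.
have ux : u n @[n --> \oo] --> x0.
  apply/cvgrPdist_lt => e e0; near=> n.
  apply: lt_trans (uP n).1 _.
  by near: n; exact: near_infty_natSinv_lt (PosNum e0).
have : U mu x0 <= c%:E.
  have mk2 x : measurable_fun setT (fun y : T => k (x, y)) by exact: measurable_fun_pair2.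
  apply: le_trans (@limn_einf_le _ (fun n => U mu (u n)) _ _ (fun n => (uP n).2) _);
    last exact: cvg_cst.
  apply: (fatou_ae (m := mu) (f_ := fun n y => k (u n, y))) => //.
  apply: aeW => y; rewrite (cvg_limn_einf_sup (k_cvg ux (cvg_cst y))).1.
  exact: lexx.
by rewrite leNgt cU.
Unshelve. all: by end_near. Qed.

(** If U exceeded w at a point of the support, lower semicontinuity would make it exceed some c > w
    on a ball of positive mass; together with U >= w on F, the energy would be larger than w. *)
Lemma minimizer_support lambda (w : R) : M1 F lambda ->
  E lambda lambda <= w%:E -> (0 <= w)%R ->
  (forall x, F x -> w%:E <= U lambda x) ->
  forall x, msupport lambda x -> U lambda x = w%:E.
Proof.
move=> lF Ew w0 FU x0 Sx0; apply/eqP; rewrite eq_le FU ?andbT; last first.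
  exact: (msupport_sub cF lF).
rewrite leNgt; apply/negP => wU.
have [c wc cU] : exists2 c : R, (w < c)%R & c%:E < U lambda x0.
  move: wU; case: (U lambda x0) => [r| |]// wr.
    exists ((w + r) / 2)%R; rewrite ?lte_fin in wr *; lra.
  by exists (w + 1)%R; rewrite ?ltry//; lra.
have [e e0 xe] := potential_lsc cU.
pose V : set T := ball x0 e.
have mV : measurable V by exact: measurable_ball.
have V0 : 0 < lambda V by apply: Sx0; [exact: ball_open|exact: ballxx].
have fV : lambda V \is a fin_num by rewrite fin_num_measure.
pose f (x : T) : \bar R := w%:E + (c - w)%:E * (\1_V x)%:E.
have mf0 : measurable_fun setT (fun x : T => (\1_V x : R)%:E).
  by apply/measurable_EFinP; exact: measurable_indic.
have mf1 : measurable_fun setT (fun x : T => (c - w)%:E * (\1_V x : R)%:E).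
  exact: measurable_funeM.
have f10 (x : T) : 0 <= (c - w)%:E * (\1_V x : R)%:E.
  by rewrite mule_ge0// lee_fin//; lra.
have : \int[lambda]_x f x <= E lambda lambda.
  apply: ae_ge0_le_integral => //.
  - by move=> x _; rewrite adde_ge0.
  - by apply: emeasurable_funD.
  have [N [mN N0 NU]] := @ae_M1 lambda (fun x => f x <= U lambda x) lF
    ltac:(move=> x Fx; rewrite /f indicE; case: (boolP (x \in V)) => xV;
      [rewrite inE in xV; rewrite mule1 -EFinD addrC subrK; exact/ltW/xe
      |rewrite mule0 adde0; exact: FU]).
  by exists N; split => // x /= nle; apply: NU => /= le; exact: nle.
have cw : 0 <= (c - w)%:E by rewrite lee_fin; lra.
have we : 0 <= w%:E by rewrite lee_fin.
have f00 (x : T) : 0 <= (\1_V x : R)%:E by rewrite lee_fin.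
rewrite ge0_integralD// ge0_integralZl//.
have intV : \int[lambda]_x (\1_V x)%:E = lambda V by rewrite integral_indic// setIT.
rewrite integral_prob_cst intV => /le_trans /(_ Ew).
rewrite -(fineK fV) -EFinM -EFinD lee_fin.
have : (0 < (c - w) * fine (lambda V))%R.
  by rewrite mulr_gt0 ?subr_gt0// -lte_fin fineK.
lra.
Qed.

End equilibrium_characterization.

(** * The map phi on the real line *)

Section real_phi.
Context {R : realType}.
Implicit Types x y t : R.

(* sgn x * sqrt (x ^ 2 - 1) for |x| >= 1 and 0 on [-1, 1], where Num.sqrt of a
   negative number is 0: this makes phiR continuous on the whole line. *)
Definition rootR x : R :=
  Num.sqrt (Num.max 0 x ^+ 2 - 1) - Num.sqrt (Num.max 0 (- x) ^+ 2 - 1).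

Definition phiR x : R := x + rootR x.

(** For |x| > 1 this is the inverse of [phiR x], since x ^ 2 - rootR x ^ 2 = 1. Written without
    division, it is continuous on the whole line. *)
Definition invphiR x : R := x - rootR x.

(** The maximum with 1 is inactive for |x| > 1, where |phi| > 1; on [-1, 1] it makes the function 0,
    hence continuous and nonnegative everywhere. *)
Definition psiR x : R := ln (Num.max 1 `|phiR x|).

Lemma sqrt_max0_continuous : continuous (fun x : R => Num.sqrt (Num.max 0 x ^+ 2 - 1)).
Proof.
move=> x; apply: (@continuous_comp _ _ _ (fun x => Num.max 0 x ^+ 2 - 1) Num.sqrt);
  last exact: sqrt_continuous.
have cmax : {for x, continuous (fun y : R => Num.max 0 y)}.
  by apply: continuous_max; [exact: cvg_cst|exact: cvg_id].
have csq : {for x, continuous (fun y : R => Num.max 0 y ^+ 2)}.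
  apply: (@continuous_comp _ _ _ (fun y : R => Num.max 0 y) (fun y : R => y ^+ 2));
    [exact: cmax|exact: exprn_continuous].
by apply: cvgB; [exact: csq|exact: cvg_cst].
Qed.

Lemma rootR_continuous : continuous rootR.
Proof.
move=> x; apply: cvgB; first exact: sqrt_max0_continuous.
apply: (@continuous_comp _ _ _ (-%R) (fun x => Num.sqrt (Num.max 0 x ^+ 2 - 1))).
  exact: opp_continuous.
exact: sqrt_max0_continuous.
Qed.

Lemma phiR_continuous : continuous phiR.
Proof. by move=> x; apply: cvgD; [exact: cvg_id|exact: rootR_continuous]. Qed.

Lemma invphiR_continuous : continuous invphiR.
Proof. by move=> x; apply: cvgB; [exact: cvg_id|exact: rootR_continuous]. Qed.

Lemma psiR_continuous : continuous psiR.
Proof.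
move=> x; apply: (@continuous_comp _ _ _ (fun x => Num.max 1 `|phiR x|) (@ln R)).
  apply: continuous_max; first exact: cvg_cst.
  apply: (@continuous_comp _ _ _ phiR (Num.norm : R -> R)); first exact: phiR_continuous.
  exact: norm_continuous.
by apply: continuous_ln; rewrite lt_max ltr01.
Qed.

Lemma psiR_ge0 x : 0 <= psiR x.
Proof. by rewrite ln_ge0// le_max lexx. Qed.

Lemma rootRE x : 1 < `|x| -> rootR x = x * Num.sqrt (1 - (x ^+ 2)^-1).
Proof.
move=> x1; have x0 : x != 0 by apply: contraTneq x1 => ->; rewrite normr0 ltr10.
have x20 : 0 < x ^+ 2 by rewrite exprn_even_gt0.
have -> : Num.sqrt (1 - (x ^+ 2)^-1) = Num.sqrt (x ^+ 2 - 1) / `|x|.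
  rewrite -sqrtr_sqr -sqrtrV ?sqr_ge0// -sqrtrM; last first.
    by rewrite subr_ge0 -real_normK ?num_real// exprn_ege1// ltW.
  by rewrite mulrBl mulfV ?gt_eqF// mul1r.
have s0 : Num.sqrt (0 ^+ 2 - 1 : R) = 0 by apply: ler0_sqrtr; rewrite expr0n/=; lra.
rewrite /rootR; have [xp|xn] := ltP 0 x.
  rewrite max_l ?oppr_le0 ?ltW// s0 subr0 gtr0_norm// mulrCA.
  by rewrite mulfV// mulr1.
rewrite max_r ?oppr_ge0// s0 sub0r sqrrN ler0_norm// invrN mulrN mulrN.
by rewrite mulrCA mulfV// mulr1.
Qed.

Lemma phiR_invphiR x : 1 < `|x| -> phiR x * invphiR x = 1.
Proof.
move=> x1; have x0 : x != 0 by apply: contraTneq x1 => ->; rewrite normr0 ltr10.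
have x20 : 0 < x ^+ 2 by rewrite exprn_even_gt0.
rewrite /phiR /invphiR mulrC -subr_sqr rootRE// exprMn sqr_sqrtr; last first.
  rewrite subr_ge0 invf_le1// -real_normK ?num_real// exprn_ege1// ltW//.
by rewrite mulrBr mulr1 mulfV ?gt_eqF// opprB addrC subrK.
Qed.

Lemma phiR_norm x : 1 < `|x| -> `|x| <= `|phiR x| <= `|x| *+ 2.
Proof.
move=> x1; have x0 : x != 0 by apply: contraTneq x1 => ->; rewrite normr0 ltr10.
have x20 : 0 < x ^+ 2 by rewrite exprn_even_gt0.
have -> : phiR x = x * (1 + Num.sqrt (1 - (x ^+ 2)^-1)).
  by rewrite /phiR rootRE// mulrDr mulr1.
have s0 := sqrtr_ge0 (1 - (x ^+ 2)^-1).
have s1 : Num.sqrt (1 - (x ^+ 2)^-1) <= 1.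
  by rewrite -[leRHS]sqrtr1 ler_wsqrtr// gerBl invr_ge0 ltW.
rewrite normrM (ger0_norm (x := 1 + _)) ?addr_ge0// -mulr_natr.
have x0' := normr_ge0 x.
by rewrite ler_peMr//=; [rewrite ler_wpM2l//; lra|lra].
Qed.

Lemma phiR_gt1 x : 1 < `|x| -> 1 < `|phiR x|.
Proof. by move=> x1; have /andP[+ _] := phiR_norm x1; exact: lt_le_trans. Qed.

Lemma half_phiR_invphiR x : phiR x + invphiR x = x *+ 2.
Proof. by rewrite /phiR /invphiR addrACA subrr addr0 -mulr2n. Qed.

(** The substitution 2 x = phi + 1/phi, and the same for t, makes both sides equal once the product
    on the left is expanded with phi (1/phi) = 1. *)
Lemma phiR_sub x t : 1 < `|x| -> 1 < `|t| ->
  `|1 - phiR x * phiR t| * `|invphiR x - invphiR t| = `|x - t| *+ 2.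
Proof.
move=> x1 t1; rewrite -normrM -normrMn; congr (`| _ |).
have ex := phiR_invphiR x1; have et := phiR_invphiR t1.
rewrite mulrnBl -!half_phiR_invphiR.
have -> : (1 - phiR x * phiR t) * (invphiR x - invphiR t) =
  (phiR t * invphiR t) * phiR x - (phiR x * invphiR x) * phiR t
    + invphiR x - invphiR t by ring.
by rewrite ex et; ring.
Qed.

End real_phi.

(** * The two forms of the logarithmic kernel *)

Section log_kernel_real.
Local Open Scope complex_scope.
Context {R : realType}.
Implicit Types (x t L : R).

Lemma sqrtc_real x : 0 <= x -> sqrtc x%:C = (Num.sqrt x)%:C.
Proof.
move=> x0; rewrite /sqrtc /= eqxx mul1r expr0n/= addr0 sqrtr_sqr ger0_norm//.
have -> : (x + x) / 2%:R = x by rewrite -mulr2n -[x *+ 2]mulr_natr mulfK// pnatr_eq0.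
by rewrite subrr mul0r sqrtr0.
Qed.

Lemma normc_real x : Normc.normc x%:C = `|x|.
Proof. by rewrite /= expr0n/= addr0 sqrtr_sqr. Qed.

Lemma phi_real x : 1 < `|x| -> phi x%:C = (phiR x)%:C.
Proof.
move=> x1; rewrite /phi /phiR rootRE//.
have -> : 1 - (x%:C ^+ 2)^-1 = (1 - (x ^+ 2)^-1)%:C.
  by rewrite rmorphB rmorph1 fmorphV rmorphXn.
rewrite sqrtc_real ?rmorphD ?rmorphM//.
have x0 : x != 0 by apply: contraTneq x1 => ->; rewrite normr0 ltr10.
rewrite subr_ge0 invf_le1; last by rewrite exprn_even_gt0.
by rewrite -real_normK ?num_real// exprn_ege1// ltW.
Qed.

Lemma psi_real x : 1 < `|x| -> psi x%:C = psiR x.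
Proof.
move=> x1; rewrite /psi phi_real// normc_real /psiR max_r// ltW//.
exact: phiR_gt1.
Qed.

Lemma norm_1BphiR_gt0 x t : 1 < `|x| -> 1 < `|t| -> 0 < `|1 - phiR x * phiR t|.
Proof.
move=> x1 t1; rewrite normr_gt0 subr_eq0; apply/eqP => e.
have : 1 < `|phiR x * phiR t|.
  by rewrite normrM -[ltLHS]mul1r ltr_pM// phiR_gt1.
by rewrite -e normr1 ltxx.
Qed.

Lemma log_kernel_real x t : 1 < `|x| -> 1 < `|t| -> log_kernel x%:C t%:C =
  if x == t then +oo%E else (ln `|1 - phiR x * phiR t| - ln `|x - t| *+ 2)%:E.
Proof.
move=> x1 t1; rewrite /log_kernel !phi_real//.
have -> : 1 - (phiR x)%:C * (phiR t)%:C = (1 - phiR x * phiR t)%:C.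
  by rewrite rmorphB rmorph1 rmorphM.
have -> : x%:C - t%:C = (x - t)%:C by rewrite rmorphB.
have n0 := norm_1BphiR_gt0 x1 t1.
rewrite !normc_real; have [->|xt] := eqVneq x t.
  by rewrite subrr normr0 expr0n/= inve0 gt0_muley// lte_fin; exact: norm_1BphiR_gt0.
have d0 : 0 < `|x - t| by rewrite normr_gt0 subr_eq0.
rewrite inver gt_eqF ?exprn_gt0// -EFinM lne_EFin ?divr_gt0 ?exprn_gt0//.
by rewrite ln_div ?posrE ?exprn_gt0// lnXn.
Qed.

Lemma logplus_small L d : 0 < `|d| <= L -> logplus L d = (ln L - ln `|d|)%:E.
Proof.
move=> /andP[d0 dL]; rewrite /logplus -normr_eq0 gt_eqF// -ln_div ?posrE//.
  by rewrite max_r// ln_ge0// ler_pdivlMr// mul1r.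
exact: lt_le_trans dL.
Qed.

Lemma log_kernelE L x t : 1 < `|x| -> 1 < `|t| -> `|x - t| <= L -> 0 < L ->
  log_kernel x%:C t%:C =
  (logplus L (x - t) + logplus L (x - t)
    + (ln `|1 - phiR x * phiR t| - ln L *+ 2)%:E)%E.
Proof.
move=> x1 t1 xtL L0; rewrite log_kernel_real//.
have [->|xt] := eqVneq x t; first by rewrite !subrr /logplus eqxx.
have d0 : 0 < `|x - t| by rewrite normr_gt0 subr_eq0.
by rewrite logplus_small ?d0// -!EFinD; congr EFin; ring.
Qed.

Lemma invphiR_norm x : 1 < `|x| -> `|invphiR x| <= 1.
Proof.
move=> x1; have p1 := phiR_gt1 x1.
have e : `|phiR x| * `|invphiR x| = 1 by rewrite -normrM phiR_invphiR ?normr1.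
by rewrite -e ler_peMl// ltW.
Qed.

(** Taking logarithms in [phiR_sub] trades |1 - phi(x) phi(t)| for the difference of the inverses.
    These lie in [-1, 1], so L >= 2 keeps the truncation inactive. *)
Lemma log_kernel_split L x t : 1 < `|x| -> 1 < `|t| -> `|x - t| <= L -> 2 <= L ->
  log_kernel x%:C t%:C =
  (logplus L (x - t) + logplus L (invphiR x - invphiR t)
    + (ln 2 - ln L *+ 2)%:E)%E.
Proof.
move=> x1 t1 xtL L2; rewrite log_kernel_real//.
have [->|xt] := eqVneq x t; first by rewrite !subrr /logplus eqxx.
have d0 : 0 < `|x - t| by rewrite normr_gt0 subr_eq0.
have n0 := norm_1BphiR_gt0 x1 t1.
have e := phiR_sub x1 t1.
have u0 : 0 < `|invphiR x - invphiR t|.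
  by rewrite -(pmulr_rgt0 _ n0) e pmulrn_lgt0.
rewrite !logplus_small ?d0 ?u0//=; last first.
  apply: le_trans (ler_normB _ _) _; apply: le_trans L2.
  by apply: lerD; exact: invphiR_norm.
have := congr1 (@ln R) e; rewrite lnM ?posrE// -[_ *+ 2]mulr_natr lnM ?posrE// => le.
by rewrite -!EFinD; congr EFin; rewrite !mulr2n; lra.
Qed.

End log_kernel_real.

(** * Integration against measures concentrated on F *)

Section concentrated.
Local Open Scope ereal_scope.
Context {R : realType}.
Local Notation T := (measurableTypeR R).
Local Notation P := (probability T R).
Implicit Types mu nu : P.
Variable F : set R.
Hypothesis mF : measurable (F : set T).

Lemma integral_M1 mu (g : T -> \bar R) : M1 F mu ->
  measurable_fun setT g -> (forall x, 0 <= g x) ->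
  \int[mu]_(x in F) g x = \int[mu]_x g x.
Proof.
move=> muF mg g0; rewrite (ge0_negligible_integral (measurableC mF) _ mg _ muF)//.
by rewrite setTD setCK.
Qed.

(** The constant may be negative and the integral of g infinite, so additivity goes through the
    positive and negative parts of h = g + c: with c = cp - cn one integrates h^+ + cn = g + cp +
    h^-, where h^- <= cn has a finite integral. *)
Lemma integral_M1_shift mu (f g : T -> \bar R) (c : R) : M1 F mu ->
  measurable_fun setT g -> (forall x, 0 <= g x) ->
  (forall x, F x -> f x = g x + c%:E) ->
  \int[mu]_(x in F) f x = \int[mu]_x g x + c%:E.
Proof.
move=> muF mg g0 fg; rewrite -(integral_M1 muF mg g0).
rewrite (@eq_integral _ _ _ mu F (fun x => g x + c%:E)); last first.
  by move=> x; rewrite inE; exact: fg.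
have muF1 : mu F = 1.
  have := probability_setC mu mF.
  rewrite muF => /eqP; rewrite eq_sym sube_eq ?add0e ?fin_num_measure//.
  by move=> /eqP.
have intc (r : R) : \int[mu]_(x in F) r%:E = r%:E.
  by rewrite integral_cst// -[RHS]mule1; congr (_ * _).
pose h x := g x + c%:E.
have mh : measurable_fun F h.
  by apply: measurable_funTS; apply: emeasurable_funD.
have mgF : measurable_fun F g by exact: measurable_funTS.
have mhp := measurable_funepos mh.
have mhn := measurable_funeneg mh.
pose cp : R := Num.max c 0%R; pose cn : R := Num.max (- c)%R 0%R.
have cp0 : (0 <= cp)%R by rewrite le_max lexx orbT.
have cn0 : (0 <= cn)%R by rewrite le_max lexx orbT.
have cpn : (c = cp - cn)%R.
  by rewrite /cp /cn; case: (leP c 0%R) => c0; [rewrite max_l|rewrite max_r]; lra.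
have hn_le x : h^\- x <= cn%:E.
  rewrite funenegE /h ge_max; apply/andP; split; last by rewrite lee_fin.
  have ccn : (- c <= cn)%R by rewrite le_max lexx.
  case: (g x) (g0 x) => [r| |]// r0; last by rewrite leNye.
  by rewrite lee_fin in r0; rewrite -EFinD -EFinN lee_fin; lra.
have hpn x : h^\+ x + cn%:E = (g x + cp%:E) + h^\- x.
  rewrite funeposE funenegE /h; case: (g x) (g0 x) => [r| |]// r0.
    rewrite -EFinD -EFin_max -EFinN -EFin_max -!EFinD cpn; congr EFin.
    case: (leP (r + (cp - cn))%R 0%R) => h1; [rewrite max_l ?max_r|rewrite max_r]; lra.
  by rewrite !addye//= maxNye.
have fhn : \int[mu]_(x in F) h^\- x \is a fin_num.
  rewrite ge0_fin_numE ?integral_ge0//.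
  apply: (@le_lt_trans _ _ (\int[mu]_(x in F) cn%:E)); last by rewrite intc ltry.
  exact: ge0_le_integral.
have e : \int[mu]_(x in F) h^\+ x + cn%:E =
    \int[mu]_(x in F) g x + cp%:E + \int[mu]_(x in F) h^\- x.
  rewrite -{1}(intc cn) -{1}(intc cp) -!ge0_integralD//.
  - by apply: eq_integral => x _; rewrite hpn.
  - by move=> x _; rewrite adde_ge0.
  - exact: emeasurable_funD.
rewrite -/h integralE; move: e fhn.
move: (\int[mu]_(x in F) h^\+ x) (\int[mu]_(x in F) g x) (\int[mu]_(x in F) h^\- x).
move=> [a| |] [b| |] [d| |] //= -[e] _.
by rewrite -?EFinD; congr EFin; lra.
Qed.

Lemma mutual_energy_le (k1 k2 : T * T -> \bar R) mu nu : M1 F mu -> M1 F nu ->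
  measurable_fun setT k1 -> (forall p, 0 <= k1 p) ->
  measurable_fun setT k2 -> (forall p, 0 <= k2 p) ->
  (forall x t, F x -> F t -> k1 (x, t) <= k2 (x, t)) ->
  mutual_energy k1 mu nu <= mutual_energy k2 mu nu.
Proof.
move=> muF nuF mk1 k10 mk2 k20 k12; rewrite /mutual_energy.
have mi (k : T * T -> \bar R) (m : P) : measurable_fun setT k -> (forall p, 0 <= k p) ->
    measurable_fun setT (fun x => \int[m]_y k (x, y)).
  by move=> mk k0; exact: measurable_fun_fubini_tonelli_F.
have mi1 (k : T * T -> \bar R) (x : T) : measurable_fun setT k ->
    measurable_fun setT (fun y : T => k (x, y)).
  by move=> mk; exact: measurable_fun_pair2.
rewrite -(integral_M1 muF (mi k1 nu mk1 k10)); last by move=> x; exact: integral_ge0.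
rewrite -(integral_M1 muF (mi k2 nu mk2 k20)); last by move=> x; exact: integral_ge0.
apply: ge0_le_integral => //.
- by move=> x _; apply: integral_ge0.
- by apply: measurable_funTS; exact: mi.
- by apply: measurable_funTS; exact: mi.
move=> x Fx; rewrite -(integral_M1 nuF (mi1 k1 x mk1))// -(integral_M1 nuF (mi1 k2 x mk2))//.
apply: ge0_le_integral => //.
- by apply: measurable_funTS; exact: mi1.
- by apply: measurable_funTS; exact: mi1.
- by move=> t Ft; exact: k12.
Qed.

End concentrated.

(** * Continuity, positivity and equality case of the total kernel *)

Lemma logplus_cvg (R : realType) (X : Type) (G : set_system X) (FG : Filter G)
    (L : R) (u : X -> R) (d : R) : 0 < L ->
  u n @[n --> G] --> d -> logplus L (u n) @[n --> G] --> logplus L d.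
Proof.
move=> L0 ud; have [d0|d0] := eqVneq d 0.
  rewrite d0 {2}/logplus eqxx; apply/cvgeyPge => A.
  have e0 : 0 < L * expR (- A) by rewrite mulr_gt0 ?expR_gt0.
  move: ud; rewrite d0 => /cvgrPdist_lt/(_ _ e0); apply: filterS => n.
  rewrite sub0r normrN /logplus; have [_|un0] := eqVneq (u n) 0; first by rewrite leey.
  have u0 : 0 < `|u n| by rewrite normr_gt0.
  move=> uL; rewrite lee_fin le_max; apply/orP; right.
  rewrite -ler_expR lnK ?posrE ?divr_gt0// ler_pdivlMr// mulrC.
  by rewrite -ler_pdivlMr ?expR_gt0// -expRN ltW.
rewrite {2}/logplus (negbTE d0).
pose f (y : R) := Num.max 0 (ln (L / `|y|)).
have cf : {for d, continuous f}.
  apply: continuous_max; first exact: cvg_cst.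
  apply: (@continuous_comp _ _ _ (fun y : R => L / `|y|) (@ln R)); last first.
    by apply: continuous_ln; rewrite divr_gt0// normr_gt0.
  apply: cvgM; first exact: cvg_cst.
  apply: cvgV; first by rewrite normr_eq0.
  exact: norm_continuous.
have fud : f (u n) @[n --> G] --> f d by exact: (cvg_comp _ _ ud cf).
apply: cvg_trans (cvg_EFin _ _ : (f (u n))%:E @[n --> G] --> (f d)%:E).
- apply: near_eq_cvg; near=> n; rewrite /logplus ifF//; apply/negbTE.
  near: n; exact: (cvgr_neq0 _ ud d0).
- by apply: nearW.
- exact: fud.
Unshelve. all: by end_near. Qed.

Section total_kernel.
Local Open Scope ereal_scope.
Context {R : realType}.
Local Notation T := (measurableTypeR R).
Local Notation P := (probability T R).
Implicit Types mu nu : P.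
Variable L : R.
Hypothesis L0 : (0 < L)%R.

Definition inv_kernel (p : T * T) : \bar R :=
  logplus_kernel L (invphiR p.1 : T, invphiR p.2 : T).

Definition weight_kernel (p : T * T) : \bar R := (psiR p.1 + psiR p.2)%:E.

(* Up to an additive constant and on F, the kernel of J_psi. *)
Definition total_kernel := (inv_kernel \+ weight_kernel) \+ logplus_kernel L.

Lemma measurable_invphiR : measurable_fun setT (invphiR : T -> T).
Proof.
have /continuous_measurable_fun := @invphiR_continuous R.
exact.
Qed.

Lemma measurable_psiR : measurable_fun setT (psiR : T -> R).
Proof.
have /continuous_measurable_fun := @psiR_continuous R.
exact.
Qed.

Lemma measurable_inv_kernel : measurable_fun setT inv_kernel.
Proof.
apply: (measurableT_comp (measurable_logplus_kernel L0)
  (g := fun p : T * T => (invphiR p.1 : T, invphiR p.2 : T))).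
by apply: measurable_fun_pair; apply: measurableT_comp => //; exact: measurable_invphiR.
Qed.

Lemma inv_kernel_ge0 p : 0 <= inv_kernel p.
Proof. exact: logplus_kernel_ge0. Qed.

Lemma measurable_weight_kernel : measurable_fun setT weight_kernel.
Proof.
apply/measurable_EFinP; apply: measurable_funD;
  by apply: measurableT_comp => //; exact: measurable_psiR.
Qed.

Lemma weight_kernel_ge0 p : 0 <= weight_kernel p.
Proof. by rewrite lee_fin addr_ge0// psiR_ge0. Qed.

Lemma measurable_rest_kernel : measurable_fun setT (inv_kernel \+ weight_kernel).
Proof.
apply: emeasurable_funD; first exact: measurable_inv_kernel.
exact: measurable_weight_kernel.
Qed.

Lemma rest_kernel_ge0 p : 0 <= (inv_kernel \+ weight_kernel) p.
Proof. by rewrite adde_ge0// ?inv_kernel_ge0 ?weight_kernel_ge0. Qed.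

Lemma measurable_total_kernel : measurable_fun setT total_kernel.
Proof.
apply: emeasurable_funD; first exact: measurable_rest_kernel.
exact: measurable_logplus_kernel.
Qed.

Lemma total_kernel_ge0 p : 0 <= total_kernel p.
Proof. by rewrite adde_ge0// ?rest_kernel_ge0 ?logplus_kernel_ge0. Qed.

Lemma logplusN (d : R) : logplus L (- d) = logplus L d.
Proof. by rewrite /logplus oppr_eq0 normrN. Qed.

Lemma total_kernel_sym x y : total_kernel (x, y) = total_kernel (y, x).
Proof.
rewrite /total_kernel /inv_kernel /weight_kernel /logplus_kernel/=.
by rewrite -(logplusN (invphiR x - invphiR y)) -(logplusN (x - y))
  !opprB (addrC (psiR x)).
Qed.

(** The energy of an additive kernel is a sum of one term per measure, so it adds the same amount to
    both sides of the positivity inequality. *)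
Lemma weight_energy mu nu : mutual_energy weight_kernel mu nu =
  \int[mu]_x (psiR x)%:E + \int[nu]_x (psiR x)%:E.
Proof.
have mpsi : measurable_fun setT (fun x : T => (psiR x)%:E).
  by apply/measurable_EFinP; exact: measurable_psiR.
have psi0 (x : T) : 0 <= (psiR x)%:E by rewrite lee_fin psiR_ge0.
rewrite /mutual_energy /weight_kernel/=.
under eq_integral do under eq_integral do rewrite EFinD.
have int1 (x : T) : \int[nu]_y ((psiR x)%:E + (psiR y)%:E) =
    (psiR x)%:E + \int[nu]_y (psiR y)%:E.
  by rewrite ge0_integralD// integral_prob_cst.
under eq_integral do rewrite int1.
rewrite ge0_integralD// ?integral_prob_cst//.
by move=> x _; exact: integral_ge0.
Qed.

Lemma diff_posdef_rest : diff_posdef (inv_kernel \+ weight_kernel).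
Proof.
apply: diff_posdefD.
- exact: measurable_inv_kernel.
- exact: inv_kernel_ge0.
- apply: (@diff_posdef_comp _ _ _ (logplus_kernel L) (invphiR : T -> T)).
  + exact: measurable_invphiR.
  + exact: measurable_logplus_kernel.
  + exact: logplus_kernel_ge0.
  + exact: diff_posdef_logplus.
- exact: measurable_weight_kernel.
- exact: weight_kernel_ge0.
- by move=> mu nu; rewrite !weight_energy addeACA.
Qed.

Lemma diff_posdef_total : diff_posdef total_kernel.
Proof.
apply: diff_posdefD.
- exact: measurable_rest_kernel.
- exact: rest_kernel_ge0.
- exact: diff_posdef_rest.
- exact: measurable_logplus_kernel.
- exact: logplus_kernel_ge0.
- exact: diff_posdef_logplus.
Qed.

Lemma total_kernel_cvg (X : Type) (G : set_system X) (FG : Filter G)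
    (u v : X -> R) (x y : R) :
  u n @[n --> G] --> x -> v n @[n --> G] --> y ->
  total_kernel (u n, v n) @[n --> G] --> total_kernel (x, y).
Proof.
move=> ux vy; have def (a b : \bar R) : 0 <= a -> 0 <= b -> a +? b.
  by move=> a0 b0; exact: ge0_adde_def.
apply: cvgeD; first by apply: def; [exact: rest_kernel_ge0|exact: logplus_kernel_ge0].
- apply: cvgeD; first by apply: def; [exact: inv_kernel_ge0|exact: weight_kernel_ge0].
  + apply: logplus_cvg => //; apply: cvgB.
      exact: (cvg_comp _ _ ux (@invphiR_continuous R x)).
    exact: (cvg_comp _ _ vy (@invphiR_continuous R y)).
  + apply: cvg_EFin; first by apply: nearW.
    apply: cvgD; first exact: (cvg_comp _ _ ux (@psiR_continuous R x)).
    exact: (cvg_comp _ _ vy (@psiR_continuous R y)).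
- by apply: logplus_cvg => //; exact: cvgB.
Qed.

Lemma logplus_energy_le mu nu :
  mutual_energy (logplus_kernel L) mu nu <= mutual_energy total_kernel mu nu.
Proof.
rewrite mutual_energyD.
- by rewrite leeDr// mutual_energy_ge0//; exact: rest_kernel_ge0.
- exact: measurable_rest_kernel.
- exact: rest_kernel_ge0.
- exact: measurable_logplus_kernel.
- exact: logplus_kernel_ge0.
Qed.

Lemma total_energy_eq a mu nu : (0 < a)%R -> (a *+ 2 < L)%R ->
  mu (~` `[(- a)%R, a]%classic) = 0 -> nu (~` `[(- a)%R, a]%classic) = 0 ->
  mutual_energy total_kernel mu mu < +oo -> mutual_energy total_kernel nu nu < +oo ->
  mutual_energy total_kernel mu mu + mutual_energy total_kernel nu nu <=
    mutual_energy total_kernel mu nu + mutual_energy total_kernel mu nu ->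
  same_measure mu nu.
Proof.
move=> a0 aL mua nua mufin nufin munu.
have lmu := le_lt_trans (logplus_energy_le mu mu) mufin.
have lnu := le_lt_trans (logplus_energy_le nu nu) nufin.
apply: (logplus_energy_eq a0 aL mua nua lmu lnu).
apply: diff_posdefD_cancel mufin nufin munu.
- exact: measurable_rest_kernel.
- exact: rest_kernel_ge0.
- exact: diff_posdef_rest.
- exact: measurable_logplus_kernel.
- exact: logplus_kernel_ge0.
- apply: mutual_energy_fin lmu lnu.
  + exact: logplus_kernel_ge0.
  + exact: diff_posdef_logplus.
Qed.

End total_kernel.

(** * J_psi, potential and energy in terms of the total kernel *)

Section functionals.
Local Open Scope ereal_scope.
Local Open Scope complex_scope.
Context {R : realType}.
Local Notation T := (measurableTypeR R).
Local Notation P := (probability T R).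
Implicit Types mu nu : P.
Variables (F : set R) (a delta L : R).
Hypothesis cF : closed F.
Hypothesis delta0 : (0 < delta)%R.
Hypothesis Fdelta : forall x, F x -> (1 + delta <= `|x| <= a)%R.
Hypothesis L2 : (2 <= L)%R.
Hypothesis aL : (a *+ 2 < L)%R.

Let L0 : (0 < L)%R. Proof. exact: lt_le_trans L2. Qed.

Let mF : measurable (F : set T). Proof. exact: closed_measurable. Qed.

Let F1 x : F x -> (1 < `|x|)%R.
Proof. by move=> /Fdelta/andP[+ _]; apply: lt_le_trans; rewrite ltrDl. Qed.

Let FL x t : F x -> F t -> (`|x - t| <= L)%R.
Proof.
move=> /Fdelta/andP[_ xa] /Fdelta/andP[_ ta].
apply: le_trans (ler_normB _ _) _; apply: le_trans (ltW aL).
by rewrite mulr2n lerD.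
Qed.

Definition log_shift : R := (ln 2 - ln L *+ 2)%R.

(** Equating [log_kernelE] and [log_kernel_split] replaces the two logarithms of the total kernel by
    twice the one in |x - t|; this is what remains. *)
Definition smooth_part x t : R :=
  (ln `|1 - phiR x * phiR t| - ln 2 + (psiR x + psiR t))%R.

Lemma total_kernelE x t : F x -> F t ->
  total_kernel L (x, t) = logplus L (x - t) + logplus L (x - t) + (smooth_part x t)%:E.
Proof.
move=> Fx Ft; have := log_kernelE (F1 Fx) (F1 Ft) (FL Fx Ft) L0.
rewrite (log_kernel_split (F1 Fx) (F1 Ft) (FL Fx Ft) L2).
rewrite /total_kernel /= /inv_kernel /weight_kernel /logplus_kernel/=.
have [->|xt] := eqVneq x t.
  by move=> _; rewrite !subrr /logplus eqxx.
rewrite /logplus subr_eq0 (negbTE xt); case: ifP => // _.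
rewrite -!EFinD => -[e]; congr EFin; rewrite /smooth_part; lra.
Qed.

Lemma smooth_part_bounded : exists H : R, forall x t, F x -> F t ->
  (`|smooth_part x t| <= H)%R.
Proof.
have d0 := delta0; have psi_le x : F x -> (0 <= psiR x <= ln (a *+ 2))%R.
  move=> Fx; have /andP[xd xa] := Fdelta Fx.
  have /andP[_ p2] := phiR_norm (F1 Fx).
  have a1 : (1 < a)%R := lt_le_trans (F1 Fx) xa.
  rewrite psiR_ge0/= /psiR ler_ln ?posrE ?lt_max ?ltr01//; last by rewrite mulr2n; lra.
  rewrite ge_max; apply/andP; split; first by rewrite mulr2n; lra.
  by apply: le_trans p2 _; rewrite lerMn2r xa.
(* [lo] comes from |phi(x) phi(t)| - 1 >= (1 + delta)^2 - 1 >= 2 delta, and [hi] from |phi| <= 2 a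
   on F. *)
pose lo : R := ln (delta *+ 2)%R; pose hi : R := ln (1 + (a *+ 2) ^+ 2)%R.
exists (`|lo| + `|hi| + ln 2 + ln (a *+ 2) *+ 2)%R => x t Fx Ft.
have /andP[xd xa] := Fdelta Fx; have /andP[td ta] := Fdelta Ft.
have /andP[px1 px2] := phiR_norm (F1 Fx); have /andP[pt1 pt2] := phiR_norm (F1 Ft).
have n0 := norm_1BphiR_gt0 (F1 Fx) (F1 Ft).
have pq : (`|phiR x| * `|phiR t| = `|phiR x * phiR t|)%R by rewrite normrM.
have lo_le : (lo <= ln `|1 - phiR x * phiR t|)%R.
  rewrite /lo ler_ln ?posrE//; last by rewrite pmulrn_lgt0.
  have : (`|phiR x * phiR t| - 1 <= `|1 - phiR x * phiR t|)%R.
    by rewrite distrC; apply: le_trans (lerB_normD _ _); rewrite normrN normr1.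
  apply: le_trans; rewrite -pq mulr2n.
  have : ((1 + delta) * (1 + delta) <= `|phiR x| * `|phiR t|)%R.
    by apply: ler_pM; [lra|lra|exact: le_trans px1|exact: le_trans pt1].
  by have := mulr_gt0 delta0 delta0; lra.
have hi_ge : (ln `|1 - phiR x * phiR t| <= hi)%R.
  rewrite /hi ler_ln ?posrE//; last by rewrite ltr_pwDl// sqr_ge0.
  apply: le_trans (ler_normB _ _) _; rewrite normr1 lerD2l -pq expr2.
  apply: ler_pM => //; first by apply: le_trans px2 _; rewrite lerMn2r xa.
  by apply: le_trans pt2 _; rewrite lerMn2r ta.
have /andP[psx0 psx] := psi_le x Fx; have /andP[pst0 pst] := psi_le t Ft.
have l2 : (0 <= ln 2 :> R)%R by rewrite ln_ge0// ler1n.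
have := ler_norm hi; have := ler_norm (- lo)%R; rewrite normrN.
have := normr_ge0 hi; have := normr_ge0 lo.
rewrite /smooth_part mulr2n => ? ? ? ?; apply/ler_normlP; split; lra.
Qed.

Lemma Jpsi_total mu : M1 F mu ->
  Jpsi F mu = mutual_energy (total_kernel L) mu mu + log_shift%:E.
Proof.
move=> muF; have mk := measurable_total_kernel L0; have k0 := @total_kernel_ge0 R L.
rewrite /Jpsi /mutual_energy; apply: (integral_M1_shift mF muF).
- exact: measurable_fun_fubini_tonelli_F.
- by move=> x; exact: integral_ge0.
move=> x Fx; apply: (integral_M1_shift mF muF) => //.
  exact: measurable_fun_pair2.
move=> t Ft; rewrite (log_kernel_split (F1 Fx) (F1 Ft) (FL Fx Ft) L2).
rewrite !psi_real ?F1// /total_kernel /= /inv_kernel /weight_kernel /logplus_kernel/=.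
have : logplus L (x - t) != -oo /\ logplus L (invphiR x - invphiR t) != -oo.
  by split; apply/eqP => e; have := logplus_ge0 L (x - t);
    have := logplus_ge0 L (invphiR x - invphiR t); rewrite e.
case: (logplus L (x - t)) => [r| |] [//= _]; case: (logplus L (invphiR x - invphiR t))
  => [r'| |]//= _; rewrite -?EFinD; congr EFin; rewrite /log_shift; lra.
Qed.

Definition psi_mass mu : R := fine (\int[mu]_x (psiR x)%:E).

Lemma psi_mass_fin mu : M1 F mu -> \int[mu]_x (psiR x)%:E \is a fin_num.
Proof.
move=> muF; have mpsi : measurable_fun setT (fun x : T => (psiR x)%:E).
  by apply/measurable_EFinP; exact: measurable_psiR.
have psi0 (x : T) : 0 <= (psiR x)%:E by rewrite lee_fin psiR_ge0.
rewrite ge0_fin_numE; last exact: integral_ge0.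
rewrite -(integral_M1 mF muF)//.
apply: (@le_lt_trans _ _ (\int[mu]_(x in F) `|ln (1 + a *+ 2)|%:E)).
  apply: ge0_le_integral => //; first exact: measurable_funTS.
  move=> x Fx; have /andP[_ xa] := Fdelta Fx.
  have /andP[_ p2] := phiR_norm (F1 Fx).
  have a1 : (1 < a)%R := lt_le_trans (F1 Fx) xa.
  rewrite lee_fin; apply: le_trans (ler_norm _).
  rewrite ler_ln ?posrE ?lt_max ?ltr01//; last by rewrite mulr2n; lra.
  rewrite ge_max; apply/andP; split; first by rewrite mulr2n; lra.
  by apply: le_trans p2 _; rewrite !mulr2n; lra.
rewrite integral_cst//; apply: lte_mul_pinfty => //.
by apply: le_lt_trans (probability_le1 mu mF) _; rewrite ltry.
Qed.

(** The total kernel contains psi(x) + psi(t). The first term is the psi of the equilibrium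
    condition; the second integrates to [psi_mass mu], which does not depend on x and is absorbed
    into the equilibrium constant. *)
Lemma potential_total mu x : M1 F mu -> F x ->
  potential F mu x%:C + (psi x%:C)%:E =
  \int[mu]_t total_kernel L (x, t) + (log_shift - psi_mass mu)%:E.
Proof.
move=> muF Fx.
have mpsi : measurable_fun setT (fun x : T => (psiR x)%:E).
  by apply/measurable_EFinP; exact: measurable_psiR.
have psi0 (t : T) : 0 <= (psiR t)%:E by rewrite lee_fin psiR_ge0.
pose g (t : T) := inv_kernel L (x, t) + logplus_kernel L (x, t).
have mg : measurable_fun setT g.
  apply: emeasurable_funD.
    apply: (measurable_fun_pair2 (f := inv_kernel L)); exact: measurable_inv_kernel.
  by apply: (measurable_fun_pair2 (f := logplus_kernel L)); exact: measurable_logplus_kernel.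
have g0 t : 0 <= g t by rewrite adde_ge0 ?inv_kernel_ge0 ?logplus_kernel_ge0.
have -> : potential F mu x%:C = \int[mu]_t g t + log_shift%:E.
  apply: (integral_M1_shift mF muF) => // t Ft.
  rewrite (log_kernel_split (F1 Fx) (F1 Ft) (FL Fx Ft) L2) /g.
  by rewrite [X in X + _ = _]addeC.
have -> : \int[mu]_t total_kernel L (x, t) =
    \int[mu]_t g t + ((psiR x)%:E + \int[mu]_t (psiR t)%:E).
  rewrite -(integral_prob_cst mu (psiR x)%:E) -!ge0_integralD//; last 2 first.
  - by move=> t _; rewrite adde_ge0.
  - exact: emeasurable_funD.
  apply: eq_integral => t _; rewrite /total_kernel /g /weight_kernel /= EFinD.
  by rewrite addeAC.
rewrite psi_real ?F1// /psi_mass; have := psi_mass_fin muF.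
case: (\int[mu]_t (psiR t)%:E) => [m| |]// _ /=.
rewrite -[LHS]addeA -[RHS]addeA; congr adde.
by rewrite -!EFinD; congr EFin; lra.
Qed.

Lemma energy_logplus mu : M1 F mu ->
  energy F mu = mutual_energy (logplus_kernel L) mu mu + (- ln L)%:E.
Proof.
move=> muF; have mk := measurable_logplus_kernel L0.
have k0 := @logplus_kernel_ge0 R L.
rewrite /energy /mutual_energy; apply: (integral_M1_shift mF muF).
- exact: measurable_fun_fubini_tonelli_F.
- by move=> x; exact: integral_ge0.
move=> x Fx; apply: (integral_M1_shift mF muF) => //.
  exact: measurable_fun_pair2.
move=> t Ft; rewrite /logplus_kernel/=; have [->|xt] := eqVneq x t.
  by rewrite subrr normr0 inve0 /logplus eqxx.
have d0 : (0 < `|x - t|)%R by rewrite normr_gt0 subr_eq0.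
rewrite logplus_small ?d0 ?FL// inver gt_eqF// lne_EFin ?invr_gt0// lnV ?posrE//.
by rewrite -EFinD; congr EFin; lra.
Qed.

(** On F the total kernel lies between the truncated logarithm and twice that logarithm plus a
    constant. *)
Lemma total_energy_lty mu : M1 F mu ->
  (mutual_energy (total_kernel L) mu mu < +oo) = (energy F mu < +oo).
Proof.
move=> muF; have mk := measurable_logplus_kernel L0.
have k0 := @logplus_kernel_ge0 R L.
rewrite (energy_logplus muF).
have lty_shift (e : \bar R) (r : R) : (e + r%:E < +oo) = (e < +oo).
  by case: e => [e| |]//; rewrite -EFinD !ltry.
rewrite lty_shift; apply/idP/idP => [|lfin].
  by apply: le_lt_trans; exact: logplus_energy_le.
have [H HP] := smooth_part_bounded.
have mc : measurable_fun setT (fun _ : T * T => `|H|%:E) by [].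
have m2 : measurable_fun setT (logplus_kernel L \+ logplus_kernel L).
  exact: emeasurable_funD.
have c0 (p : T * T) : 0 <= `|H|%:E by rewrite lee_fin.
have k20 p : 0 <= (logplus_kernel L \+ logplus_kernel L) p.
  by rewrite adde_ge0 ?k0.
apply: (@le_lt_trans _ _ (mutual_energy
    ((logplus_kernel L \+ logplus_kernel L) \+ (fun=> `|H|%:E)) mu mu)).
  apply: (mutual_energy_le mF muF muF) => //.
  - exact: measurable_total_kernel.
  - exact: total_kernel_ge0.
  - exact: emeasurable_funD.
  - by move=> p; rewrite adde_ge0.
  move=> x t Fx Ft; rewrite total_kernelE// leeD2l// lee_fin.
  exact: le_trans (ler_norm _) (le_trans (HP x t Fx Ft) (ler_norm _)).
rewrite (mutual_energyD _ _ m2 k20 mc c0) (mutual_energyD _ _ mk k0 mk k0).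
apply: lte_add_pinfty; first exact: lte_add_pinfty.
rewrite /mutual_energy.
have -> : \int[mu]_x \int[mu]_t `|H|%:E = \int[mu]_x `|H|%:E.
  by apply: eq_integral => x _; exact: integral_prob_cst.
by rewrite integral_prob_cst ltry.
Qed.

End functionals.

(** * Averages of the truncated logarithm over intervals *)

Section average.
Local Open Scope ereal_scope.
Context {R : realType}.
Local Notation T := (measurableTypeR R).
Local Notation P := (probability T R).
Local Notation leb := (@lebesgue_measure R).
Implicit Types (v c r t : R).

Lemma integral_expRN c : \int[leb]_(v in `[c, +oo[) (expR (- v))%:E = (expR (- c))%:E.
Proof.
pose F (v : R) : R := (- expR (- v))%R.
have dF (x : R) : is_derive x 1%R F (expR (- x)).
  have h := is_deriveN (is_derive1_comp (is_derive_expR (- x))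
    (is_deriveN (is_derive_id x (1%R : R^o)))).
  by apply: (is_derive_eq h); rewrite mulrN1 opprK.
have cF : continuous F.
  by move=> x; apply/differentiable_continuous/derivable1_diffP; have [] := dF x.
have cf : continuous (fun v : R => expR (- v))%R.
  by move=> x; rewrite -[X in continuous_at _ X]opprK; apply: cvgN; exact: cF.
rewrite (@ge0_continuous_FTC2y _ _ F _ 0%R).
- by rewrite sub0e -EFinN opprK.
- by move=> x _; exact: expR_ge0.
- exact: continuous_subspaceT.
- rewrite -oppr0; apply: cvgN; exact: cvgr_expR.
- by move=> x _; have [] := dF x.
- by apply: cvg_at_right_filter; exact: cF.
- by move=> x _; rewrite derive1E; have [_ ->] := dF x.
Qed.

Lemma integral_tent_le v t :
  \int[leb]_x (tent v (x - t))%:E <= (expR (- v) *+ 2)%:E.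
Proof.
have e0 := expR_gt0 (- v).
apply: (@le_trans _ _ (\int[leb]_x (\1_`[(t - expR (- v))%R, (t + expR (- v))%R] x)%:E)).
  apply: ge0_le_integral => //.
  - by move=> x _; rewrite lee_fin tent_ge0.
  - apply/measurable_EFinP; apply: measurable_maxr => //; apply: measurable_funB => //.
    apply: measurable_funM => //; apply: measurableT_comp => //.
    exact: measurable_funB.
  - by apply/measurable_EFinP; exact: measurable_indic.
  - move=> x _; rewrite lee_fin indicE mem_setE in_itv/=.
    have ev : (expR v * expR (- v) = 1)%R by rewrite expRN mulfV// gt_eqF// expR_gt0.
    have d0 := normr_ge0 ((x : R) - t)%R.
    have ev0 := expR_gt0 v.
    have tent1 : (tent v (x - t) <= 1)%R.
      by rewrite /tent ge_max ler01 lerBlDr lerDl mulr_ge0// ltW.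
    have tent0 : ~~ (t - expR (- v) <= x <= t + expR (- v))%R -> tent v (x - t) = 0%R.
      move=> xout; rewrite /tent max_l// subr_le0 -[leLHS]ev mulrC ler_pM2r// leNgt.
      apply/negP; rewrite ltr_distl => /andP[? ?]; move: xout.
      by rewrite negb_and -!ltNge => /orP[] ?; lra.
    by have [_|/tent0 ->] := boolP (_ && _); [exact: tent1|exact: lexx].
rewrite (_ : integral _ _ _ =
    leb `[(t - expR (- v))%R, (t + expR (- v))%R]%classic); last first.
  by rewrite integral_indic ?setIT//; exact: measurable_itv.
rewrite lebesgue_measure_itv/= lte_fin.
by case: ifP => _; rewrite ?lee_fin -?EFinB ?lee_fin ?mulr2n; lra.
Qed.

Lemma measurable_logplus_sub r t : (0 < r)%R ->
  measurable_fun setT (fun x : T => logplus r (x - t)).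
Proof.
move=> r0; apply: (measurable_fun_pair1 (f := logplus_kernel r)).
exact: measurable_logplus_kernel.
Qed.

(** In the tent representation each tent has integral at most 2 exp (- v); integrating over v >= -
    ln r gives 2 r, and the extra tent at v = - ln r gives 2 r again. *)
Lemma integral_logplus_le r t : (0 < r)%R ->
  \int[leb]_x logplus r (x - t) <= (r *+ 4)%:E.
Proof.
move=> r0.
pose f (p : T * T) := tail_kernel r (p.2, (p.1, t : T)).
have mf : measurable_fun setT f.
  apply: (measurableT_comp (measurable_tail_kernel r)
    (g := fun p : T * T => (p.2, (p.1, t : T)))).
  by apply: measurable_fun_pair => //; exact: measurable_fun_pair.
have f0 p : 0 <= f p by exact: tail_kernel_ge0.
have mt v : measurable_fun setT (fun x : T => (tent v (x - t))%:E).
  exact: (measurable_fun_pair1 t (measurable_tent_kernel v)).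
rewrite (_ : \int[leb]_x logplus r (x - t) =
    \int[leb]_x (\int[leb]_v f (x, v) + (tent (- ln r) (x - t))%:E)); last first.
  by apply: eq_integral => x _; rewrite logplusE.
rewrite ge0_integralD//; last 3 first.
- by move=> x _; exact: integral_ge0.
- exact: measurable_fun_fubini_tonelli_F.
- by move=> x _; rewrite lee_fin tent_ge0.
have -> : (r *+ 4)%:E = (r *+ 2)%:E + (r *+ 2)%:E by rewrite -EFinD -mulrnDr.
have tent_r := integral_tent_le (- ln r) t.
rewrite opprK lnK ?posrE// in tent_r; apply: leeD => //.
rewrite (fubini_tonelli f mf f0).
apply: (@le_trans _ _ (\int[leb]_(v in `[(- ln r)%R, +oo[) (2%:E * (expR (- v))%:E))).
  rewrite [leRHS]integral_mkcond/=; apply: ge0_le_integral => //.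
  - by move=> v _; exact: integral_ge0.
  - exact: measurable_fun_fubini_tonelli_G.
  - have mI : measurable (`[(- ln r)%R, +oo[%classic : set T) by exact: measurable_itv.
    apply/(measurable_restrictT _ mI); apply: measurable_funTS; apply: measurable_funeM; apply/measurable_EFinP.
    by apply: measurableT_comp => //; exact: measurable_funN.
  move=> v _; rewrite patchE mem_setE in_itv/= andbT /f /tail_kernel/=.
  have [_|_] := boolP (- ln r <= v)%R; last by rewrite integral0_eq.
  by have := integral_tent_le v t; rewrite -EFinM mulr_natl.
have mexp : measurable_fun (`[(- ln r)%R, +oo[%classic : set T)
    (fun v : T => (expR (- v))%:E).
  apply: measurable_funTS; apply/measurable_EFinP.
  by apply: measurableT_comp => //; exact: measurable_funN.
rewrite ge0_integralZl//.
by rewrite integral_expRN opprK lnK ?posrE// -EFinM mulr_natl.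
Qed.

Lemma logplus_le_add L r d : (0 < r)%R -> (r <= L)%R ->
  logplus L d <= (ln (L / r))%:E + logplus r d.
Proof.
move=> r0 rL; have L0 : (0 < L)%R := lt_le_trans r0 rL.
rewrite /logplus; case: eqVneq => [|d0]; first by rewrite addey.
have dp : (0 < `|d|)%R by rewrite normr_gt0.
have lr : (0 <= ln (L / r))%R by rewrite ln_ge0// ler_pdivlMr// mul1r.
rewrite -EFinD lee_fin ge_max; apply/andP; split.
  by rewrite addr_ge0// le_max lexx.
rewrite -lerBlDl le_max; apply/orP; right.
by rewrite !ln_div ?posrE//; lra.
Qed.

End average.

Section uniform_average.
Local Open Scope ereal_scope.
Context {R : realType}.
Local Notation T := (measurableTypeR R).
Local Notation P := (probability T R).
Local Notation leb := (@lebesgue_measure R).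

Lemma M1_subset (A F : set R) (mu : P) : measurable (A : set T) ->
  measurable (F : set T) -> A `<=` F -> M1 A mu -> M1 F mu.
Proof.
move=> mA mF AF muA; apply: (@subset_measure0 _ _ _ mu _ (~` A) _ _ _ muA).
- exact: measurableC.
- exact: measurableC.
- exact: subsetC.
Qed.

Lemma M1_uniform (a b : R) (ab : (a < b)%R) :
  M1 `[a, b]%classic (uniform_prob ab : P).
Proof.
by rewrite /M1/= /uniform_prob integral_uniform_pdf setICl integral_set0.
Qed.

Variables (L a b : R).
Hypothesis ab : (a < b)%R.
Hypothesis abL : (b - a <= L)%R.

Local Notation nu := (uniform_prob ab : P).

Let r0 : (0 < b - a)%R. Proof. by rewrite subr_gt0. Qed.
Let L0 : (0 < L)%R. Proof. exact: lt_le_trans r0 abL. Qed.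
Let mI : measurable (`[a, b]%classic : set T). Proof. exact: measurable_itv. Qed.

(** Passing to the logarithm truncated at scale b - a costs ln (L / (b - a)); the average of the
    latter is at most 4 (b - a) / (b - a), uniformly in t. *)
Lemma uniform_logplus_le t :
  \int[nu]_x logplus L (x - t) <= (ln (L / (b - a)) + 4)%:E.
Proof.
have mr := measurable_logplus_sub t r0.
apply: (@le_trans _ _ (\int[nu]_x ((ln (L / (b - a)))%:E + logplus (b - a) (x - t)))).
  apply: ge0_le_integral => //.
  - by move=> x _; exact: logplus_ge0.
  - exact: measurable_logplus_sub.
  - exact: emeasurable_funD.
  - by move=> x _; exact: logplus_le_add.
have lr : (0 <= ln (L / (b - a)))%R by rewrite ln_ge0// ler_pdivlMr// mul1r.
rewrite ge0_integralD//; last by move=> x _; exact: logplus_ge0.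
rewrite (integral_prob_cst nu) EFinD leeD2l// integral_uniform//; last first.
  by move=> x; exact: logplus_ge0.
apply: (@le_trans _ _ ((b - a)^-1%:E * ((b - a) *+ 4)%:E)).
  apply: lee_wpmul2l; first by rewrite lee_fin invr_ge0 ltW.
  apply: le_trans (integral_logplus_le t r0).
  by apply: ge0_subset_integral => // x _; exact: logplus_ge0.
by rewrite -EFinM mulrnAr mulVf// gt_eqF.
Qed.

(** If |x0 - t| >= 2 (b - a), then |x - t| >= |x0 - t| / 2 on the interval, at the cost of ln 2. If
    |x0 - t| < 2 (b - a), the bound ln (L / (b - a)) + 4 exceeds the value at x0 by at most ln 2 +
    4. *)
Lemma uniform_logplus_point x0 t : `[a, b]%classic x0 ->
  \int[nu]_x logplus L (x - t) <= logplus L (x0 - t) + (ln 2 + 4)%:E.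
Proof.
rewrite /= in_itv/= => /andP[ax0 x0b].
have ln2 : (0 <= ln 2 :> R)%R by rewrite ln_ge0// ler1n.
have [->|d0] := eqVneq (x0 - t)%R 0%R.
  by rewrite {2}/logplus eqxx addye// leey.
have dp : (0 < `|x0 - t|)%R by rewrite normr_gt0.
have rp := r0.
have [far|near] := leP ((b - a) *+ 2)%R `|x0 - t|%R; last first.
  apply: le_trans (uniform_logplus_le t) _.
  rewrite /logplus (negbTE d0) -EFinD lee_fin.
  suff : (ln (L / (b - a)) <= Num.max 0 (ln (L / `|x0 - t|)) + ln 2)%R by lra.
  apply: (@le_trans _ _ (ln (L / `|x0 - t|) + ln 2)%R); last first.
    by rewrite lerD2r le_max lexx orbT.
  rewrite -lnM ?posrE ?divr_gt0// ler_ln ?posrE ?divr_gt0 ?mulr_gt0 ?invr_gt0//.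
  rewrite -mulrA ler_pM2l// -[X in (_ * X)%R]invrK -invfM lef_pV2 ?posrE ?divr_gt0//.
  by rewrite mulr2n in near; lra.
pose c := logplus L (x0 - t) + (ln 2)%:E.
have c0 : 0 <= c by rewrite adde_ge0 ?logplus_ge0.
have -> : logplus L (x0 - t) + (ln 2 + 4)%:E = c + 4%:E.
  by rewrite EFinD addeA.
apply: (@le_trans _ _ c); last by rewrite leeDl.
rewrite -(integral_M1 mI (M1_uniform ab)); last 2 first.
- exact: measurable_logplus_sub.
- by move=> x; exact: logplus_ge0.
rewrite -(integral_prob_cst nu c) -(integral_M1 mI (M1_uniform ab))//.
apply: ge0_le_integral => //.
- by move=> x _; exact: logplus_ge0.
- by apply: measurable_funTS; exact: measurable_logplus_sub.
move=> x; rewrite /= in_itv/= => /andP[ax xb].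
have xx0 : (`|x - x0| <= b - a)%R by apply/ler_normlP; split; lra.
have half : (`|x0 - t| / 2 <= `|x - t|)%R.
  have : (`|x0 - t| <= `|x - x0| + `|x - t|)%R.
    rewrite -(normrN (x - x0)%R); apply: le_trans (ler_normD _ _).
    by rewrite opprB addrA subrK.
  by rewrite mulr2n in far; lra.
have xp : (0 < `|x - t|)%R by apply: lt_le_trans half; rewrite divr_gt0.
have xt0 : (x - t != 0)%R by rewrite -normr_gt0.
rewrite /c /logplus (negbTE d0) (negbTE xt0) -EFinD lee_fin ge_max.
apply/andP; split; first by rewrite addr_ge0// le_max lexx.
apply: (@le_trans _ _ (ln (L / `|x0 - t|) + ln 2)%R); last first.
  by rewrite lerD2r le_max lexx orbT.
rewrite -lnM ?posrE ?divr_gt0// ler_ln ?posrE ?divr_gt0 ?mulr_gt0 ?invr_gt0//.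
by rewrite -mulrA ler_pM2l// -[X in (_ * X)%R]invrK -invfM lef_pV2 ?posrE ?divr_gt0.
Qed.

End uniform_average.

(** * Averages over shrinking intervals *)

Section shrinking_average.
Local Open Scope ereal_scope.
Context {R : realType}.
Local Notation T := (measurableTypeR R).
Local Notation P := (probability T R).

Lemma average_bounds (nu : P) (A : set R) (f : T -> \bar R) (lo hi : R) :
  measurable (A : set T) -> M1 A nu ->
  measurable_fun setT f -> (forall x, 0 <= f x) -> A !=set0 ->
  (forall x, A x -> lo%:E <= f x <= hi%:E) ->
  lo%:E <= \int[nu]_x f x <= hi%:E.
Proof.
move=> mA nuA mf f0 [x0 Ax0] fA.
have cst_int (r : R) : (0 <= r)%R -> \int[nu]_(x in A) r%:E = r%:E.
  by move=> r0; rewrite integral_M1// integral_prob_cst.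
have hi0 : (0 <= hi)%R.
  by have /andP[_ fhi] := fA _ Ax0; rewrite -lee_fin (le_trans (f0 x0)).
rewrite -(integral_M1 mA nuA)//; apply/andP; split.
  apply: (@le_trans _ _ (Num.max 0 lo)%:E); first by rewrite lee_fin le_max lexx orbT.
  rewrite -(cst_int (Num.max 0 lo)%R); last by rewrite le_max lexx.
  apply: ge0_le_integral => //.
  - by move=> x _; rewrite lee_fin le_max lexx.
  - exact: measurable_funTS.
  - move=> x Ax; rewrite EFin_max ge_max f0/=.
    by have /andP[] := fA x Ax.
rewrite -(cst_int hi)//; apply: ge0_le_integral => //.
- exact: measurable_funTS.
- by move=> x Ax; have /andP[] := fA x Ax.
Qed.

Lemma average_cvg (nu : nat -> P) (b c : nat -> R) (f : T -> \bar R) (x0 : R) :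
  (forall n, M1 `[b n, c n]%classic (nu n)) ->
  (forall n, (b n <= x0 <= c n)%R) ->
  (forall n, (c n - b n <= n.+1%:R^-1)%R) ->
  measurable_fun setT f -> (forall x, 0 <= f x) ->
  f x0 \is a fin_num -> f x @[x --> (x0 : R)] --> f x0 ->
  \int[nu n]_x f x @[n --> \oo] --> f x0.
Proof.
move=> nuI x0I Ilen mf f0 ffin.
rewrite -(fineK ffin); set v := fine (f x0).
move=> /fine_cvgP[ffin_near fv].
have bounds (e : R) : (0 < e)%R -> \forall n \near \oo,
    (v - e)%:E <= \int[nu n]_x f x <= (v + e)%:E.
  move=> e0.
  have [d /= d0 dP] : exists2 d : R, (0 < d)%R & forall x : R, (`|x0 - x| < d)%R ->
      (v - e)%:E <= f x <= (v + e)%:E.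
    have : \forall x \near (x0 : R), (v - e)%:E <= f x <= (v + e)%:E.
      move/cvgrPdist_le : fv => /(_ _ e0) fv.
      apply: filterS2 ffin_near fv => x fxfin /=.
      rewrite -{2 3}(fineK fxfin) !lee_fin => /ler_normlP[? ?].
      by apply/andP; split; lra.
    by move=> /nbhs_ballP[d /= d0 dP]; exists d.
  near=> n; apply: (average_bounds _ (nuI n)) => //.
  - by exists x0; rewrite /= in_itv/= x0I.
  - move=> x; rewrite /= in_itv/= => /andP[bx xc]; apply: dP.
    have /andP[bx0 x0c] := x0I n.
    apply: (@le_lt_trans _ _ (c n - b n)%R).
      by apply/ler_normlP; split; lra.
    apply: le_lt_trans (Ilen n) _.
    by near: n; exact: near_infty_natSinv_lt (PosNum d0).
apply/fine_cvgP; split.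
  have := bounds 1%R ltr01; apply: filterS => n.
  by case: (\int[nu n]_x f x) => // /andP[].
apply/cvgrPdist_le => e e0; have := bounds e e0; apply: filterS => n /=.
case: (\int[nu n]_x f x) => [r| |]; [|by move=> /andP[]..].
by rewrite !lee_fin /= => /andP[? ?]; apply/ler_normlP; split; lra.
Unshelve. all: by end_near. Qed.

End shrinking_average.

(** * Lower bound for the potential of a minimizer *)

Section minimizer_potential.
Local Open Scope ereal_scope.
Context {R : realType}.
Local Notation T := (measurableTypeR R).
Local Notation P := (probability T R).
Variables (F : set R) (a delta L : R).
Hypothesis cF : closed F.
Hypothesis delta0 : (0 < delta)%R.
Hypothesis Fdelta : forall x, F x -> (1 + delta <= `|x| <= a)%R.
Hypothesis L2 : (2 <= L)%R.
Hypothesis aL : (a *+ 2 < L)%R.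
Hypothesis Fitv : forall (x : R) (e : R), F x -> (0 < e)%R ->
  exists b c : R, [/\ (b < c)%R, (c - b <= e)%R, (b <= x <= c)%R &
    `[b, c]%classic `<=` F].

Local Notation k := (total_kernel L).
Local Notation E := (mutual_energy k).

Let L0 : (0 < L)%R. Proof. exact: lt_le_trans L2. Qed.
Let mF : measurable (F : set T). Proof. exact: closed_measurable. Qed.
Let mk : measurable_fun setT k. Proof. exact: measurable_total_kernel. Qed.
Let k0 p : 0 <= k p. Proof. exact: total_kernel_ge0. Qed.
Let k_sym := @total_kernel_sym R L.
Let k_pos := diff_posdef_total L0.

Lemma uniform_M1 (b c : R) (bc : (b < c)%R) : `[b, c]%classic `<=` F ->
  M1 F (uniform_prob bc : P).
Proof.
by move=> bcF; apply: M1_subset bcF (M1_uniform bc) => //; exact: measurable_itv.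
Qed.

(** The logarithmic potential of a uniform measure is bounded, so these measures are admissible
    directions for the first variation. *)
Lemma uniform_energy_fin (b c : R) (bc : (b < c)%R) : (c - b <= L)%R ->
  `[b, c]%classic `<=` F ->
  E (uniform_prob bc : P) (uniform_prob bc : P) < +oo.
Proof.
move=> bcL bcF; have nuF := uniform_M1 bc bcF.
rewrite (total_energy_lty cF delta0 Fdelta L2 aL nuF).
rewrite (energy_logplus cF Fdelta L2 aL nuF).
apply: lte_add_pinfty; last by rewrite ltry.
apply: (@le_lt_trans _ _ (ln (L / (c - b)) + 4)%:E); last by rewrite ltry.
have mkl := measurable_logplus_kernel L0.
rewrite -[leRHS](integral_prob_cst (uniform_prob bc : P)); apply: ge0_le_integral => //.
- by move=> x _; apply: integral_ge0 => y _; exact: logplus_kernel_ge0.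
- by apply: measurable_fun_fubini_tonelli_F => // p; exact: logplus_kernel_ge0.
move=> x _; apply: le_trans (uniform_logplus_le bc bcL x).
rewrite le_eqVlt; apply/orP; left; apply/eqP; apply: eq_integral => y _.
by rewrite /logplus_kernel/= -logplusN opprB.
Qed.

Lemma uniform_total_kernel : exists C : R, forall (b c : R) (bc : (b < c)%R) (x0 t : R),
  (c - b <= L)%R -> `[b, c]%classic `<=` F -> (b <= x0 <= c)%R -> F t ->
  \int[(uniform_prob bc : P)]_x k (t, x) <= k (t, x0) + C%:E.
Proof.
have [H HP] := smooth_part_bounded delta0 Fdelta.
(* One |H| bounds the smooth part under the integral, the other restores it at x0; each of the two
   logarithms costs ln 2 + 4. *)
exists (`|H| + `|H| + ((ln 2 + 4) + (ln 2 + 4)))%R => b c bc x0 t bcL bcF x0I Ft.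
have nuF := uniform_M1 bc bcF.
have Fx0 : F x0 by apply: bcF; rewrite /= in_itv.
pose lp (x : T) := logplus L (x - t).
have mlp : measurable_fun setT lp by exact: measurable_logplus_sub.
have lp0 x : 0 <= lp x by exact: logplus_ge0.
have up : \int[(uniform_prob bc : P)]_x k (t, x) <=
    \int[(uniform_prob bc : P)]_x (lp x + lp x + `|H|%:E).
  have mkt : measurable_fun setT (fun x => k (t, x)) by exact: measurable_fun_pair2.
  have mr : measurable_fun setT (fun x => lp x + lp x + `|H|%:E).
    by apply: emeasurable_funD => //; exact: emeasurable_funD.
  have r0 x : 0 <= lp x + lp x + `|H|%:E by rewrite !adde_ge0.
  rewrite -(integral_M1 mF nuF mkt)// -(integral_M1 mF nuF mr)//.
  apply: ge0_le_integral => //; [exact: measurable_funTS..|].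
  move=> x Fx; rewrite k_sym (total_kernelE delta0 Fdelta L2 aL Fx Ft) leeD2l// lee_fin.
  exact: le_trans (ler_norm _) (le_trans (HP x t Fx Ft) (ler_norm _)).
apply: le_trans up _.
have -> : \int[(uniform_prob bc : P)]_x (lp x + lp x + `|H|%:E) =
    \int[(uniform_prob bc : P)]_x lp x + \int[(uniform_prob bc : P)]_x lp x + `|H|%:E.
  rewrite ge0_integralD//; last 2 first.
  - by move=> x _; rewrite adde_ge0.
  - exact: emeasurable_funD.
  by rewrite ge0_integralD// (integral_prob_cst (uniform_prob bc : P)).
have x0I' : `[b, c]%classic x0 by rewrite /= in_itv.
have := uniform_logplus_point bc bcL t x0I'.
rewrite -/(lp x0) k_sym (total_kernelE delta0 Fdelta L2 aL Fx0 Ft).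
rewrite -/(lp x0).
have smooth : (- `|H| <= smooth_part x0 t)%R.
  have := le_trans (HP x0 t Fx0 Ft) (ler_norm H).
  by move=> /ler_normlP[+ _]; rewrite lerNl.
have : 0 <= \int[(uniform_prob bc : P)]_x lp x by exact: integral_ge0.
case: (lp x0) (lp0 x0) => [r| |//] _; last first.
  by move=> _ _; rewrite !addye// leey.
rewrite -/lp; case: (\int[_]_x lp x) => [i| |//] _; last by rewrite -EFinD leye_eq.
by rewrite -!EFinD !lee_fin; lra.
Qed.

(* At points of F the minimality bound passes from the averages of the potential
   over short intervals to its value, because the average of the kernel exceeds
   the kernel by at most a constant. *)
Lemma minimizer_potential_ge (lambda : P) : M1 F lambda ->
  (forall mu, M1 F mu -> E lambda lambda <= E mu mu) ->
  forall x0, F x0 -> E lambda lambda <= \int[lambda]_t k (x0, t).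
Proof.
move=> lF lmin x0 Fx0; have [C CP] := uniform_total_kernel.
have -> : \int[lambda]_t k (x0, t) = \int[lambda]_t k (t, x0).
  by apply: eq_integral => t _; exact: k_sym.
(* An infinite potential at x0 leaves nothing to prove; a finite one makes k (t, x0) + C an
   integrable dominating function of t. *)
have [->|Uoo] := eqVneq (\int[lambda]_t k (t, x0)) +oo; first by rewrite leey.
have /choice[bc bcP] : forall n : nat, exists bc : {p : R * R | (p.1 < p.2)%R},
    [/\ ((val bc).2 - (val bc).1 <= Num.min L n.+1%:R^-1)%R,
        ((val bc).1 <= x0 <= (val bc).2)%R &
        `[(val bc).1, (val bc).2]%classic `<=` F].
  move=> n; have e0 : (0 < Num.min L n.+1%:R^-1)%R by rewrite lt_min L0/= invr_gt0.
  have [b [c [bc bce x0I bcF]]] := Fitv Fx0 e0.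
  by exists (exist _ (b, c) bc).
pose nu n : P := uniform_prob (valP (bc n)).
have lenL n : ((val (bc n)).2 - (val (bc n)).1 <= L)%R.
  by have [+ _ _] := bcP n; rewrite le_min => /andP[].
have nuF n : M1 F (nu n) by have [_ _ +] := bcP n; exact: uniform_M1.
have nufin n : E (nu n) (nu n) < +oo.
  by have [_ _ +] := bcP n; exact: uniform_energy_fin.
pose f_ n (t : T) := \int[nu n]_x k (t, x).
pose f (t : T) := k (t, x0).
pose g (t : T) := f t + C%:E.
have mf : measurable_fun setT f by exact: measurable_fun_pair1.
have mf_ n : measurable_fun setT (f_ n) by exact: measurable_fun_fubini_tonelli_F.
have f0 t : 0 <= f t by exact: k0.
have f_0 n t : 0 <= f_ n t by exact: integral_ge0.
have intf : lambda.-integrable F f.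
  apply/integrableP; split; first exact: measurable_funTS.
  under eq_integral do rewrite gee0_abs//.
  by rewrite (integral_M1 mF lF)// lt_neqAle Uoo leey.
have intg : lambda.-integrable F g.
  apply: integrableD => //; exact: (finite_measure_integrable_cst lambda).
(* The averages converge to k (t, x0) wherever this value is finite, which by integrability is the
   case for almost every t. *)
have f_f : {ae lambda, forall t, F t -> f_ ^~ t @ \oo --> f t}.
  have [N [mN N0 NP]] := integrable_ae mF intf.
  exists N; split => // t /= nt; apply: NP => /= fin; apply: nt => Ft.
  apply: (@average_cvg _ nu (fun n => (val (bc n)).1) (fun n => (val (bc n)).2)
    (fun x => k (t, x)) x0).
  - by move=> n; exact: M1_uniform.
  - by move=> n; have [_ + _] := bcP n.
  - by move=> n; have [+ _ _] := bcP n; rewrite le_min => /andP[].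
  - exact: measurable_fun_pair2.
  - by [].
  - exact: fin.
  - by apply: total_kernel_cvg => //; exact: cvg_cst.
have f_g : {ae lambda, forall t n, F t -> `|f_ n t| <= g t}.
  apply: aeW => t n Ft; rewrite gee0_abs//.
  by have [_ x0I bcF] := bcP n; exact: CP.
have [_ _ lim] := dominated_convergence mF (fun n => measurable_funTS (mf_ n))
  (measurable_funTS mf) f_f intg f_g.
rewrite -(integral_M1 mF lF mf f0) -(cvg_lim _ lim)//; apply: lime_ge.
  by apply/cvg_ex; eexists; exact: lim.
apply: nearW => n /=; rewrite (integral_M1 mF lF (mf_ n) (f_0 n)).
have := first_variation mk k0 k_sym k_pos lF lmin (nuF n) (nufin n).
exact.
Qed.

End minimizer_potential.

(** * The equilibrium measure of F *)

Section equilibrium_measure.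
Local Open Scope ereal_scope.
Local Open Scope complex_scope.
Context {R : realType}.
Local Notation T := (measurableTypeR R).
Local Notation P := (probability T R).
Variables (F : set R) (a delta L : R).
Hypothesis cF : closed F.
Hypothesis delta0 : (0 < delta)%R.
Hypothesis Fdelta : forall x, F x -> (1 + delta <= `|x| <= a)%R.
Hypothesis L2 : (2 <= L)%R.
Hypothesis aL : (a *+ 2 < L)%R.
Hypothesis Fitv : forall (x : R) (e : R), F x -> (0 < e)%R ->
  exists b c : R, [/\ (b < c)%R, (c - b <= e)%R, (b <= x <= c)%R &
    `[b, c]%classic `<=` F].
Hypothesis F0 : F !=set0.

Local Notation k := (total_kernel L).
Local Notation E := (mutual_energy k).

Let L0 : (0 < L)%R. Proof. exact: lt_le_trans L2. Qed.
Let mk : measurable_fun setT k. Proof. exact: measurable_total_kernel. Qed.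
Let k0 p : 0 <= k p. Proof. exact: total_kernel_ge0. Qed.
Let k_sym := @total_kernel_sym R L.
Let k_pos := diff_posdef_total L0.
Let k_cvg (u v : nat -> R) (x y : R) : u n @[n --> \oo] --> x -> v n @[n --> \oo] --> y ->
  k (u n, v n) @[n --> \oo] --> k (x, y).
Proof. by move=> ux vy; exact: total_kernel_cvg. Qed.

Let a0 : (0 < a)%R.
Proof.
have [x /Fdelta/andP[xd xa]] := F0; have d0 := delta0.
by apply: lt_le_trans xa; apply: lt_le_trans xd; lra.
Qed.

Let Fa : F `<=` `[(- a)%R, a]%classic.
Proof. by move=> x /Fdelta/andP[_]; rewrite ler_norml /= in_itv. Qed.

Lemma minimizerE (mu : P) : M1 F mu ->
  (is_minimizer F mu <-> forall nu, M1 F nu -> E mu mu <= E nu nu).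
Proof.
move=> muF; have J nu := @Jpsi_total _ _ _ _ _ cF delta0 Fdelta L2 aL nu.
split=> [[_ mumin] nu nuF|mumin].
  by have := mumin nu nuF; rewrite (J mu muF) (J nu nuF) leeD2rE.
by split; [exact: muF|move=> nu nuF]; rewrite (J mu muF) (J nu nuF); exact/leeD2r/mumin.
Qed.

(** The two inequalities add up to the reverse of the positivity inequality, that is, to its
    equality case. *)
Lemma energy_unique (mu nu : P) : M1 F mu -> M1 F nu ->
  E mu mu < +oo -> E nu nu < +oo ->
  E mu mu <= E mu nu -> E nu nu <= E mu nu -> same_measure mu nu.
Proof.
move=> muF nuF mufin nufin le1 le2.
have mua := M1_itv cF Fa muF; have nua := M1_itv cF Fa nuF.
apply: (total_energy_eq L0 a0 aL mua nua mufin nufin).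
exact: leeD le1 le2.
Qed.

Lemma equilibriumE (mu : P) : M1 F mu -> equilibrium F mu <->
  exists w : R, (forall x, msupport mu x -> \int[mu]_t k (x, t) = w%:E) /\
    (forall x, (F `\` msupport mu) x -> w%:E <= \int[mu]_t k (x, t)).
Proof.
move=> muF; have [s pot] : exists s : R, forall x, F x ->
    potential F mu x%:C + (psi x%:C)%:E = \int[mu]_t k (x, t) + s%:E.
  exists (log_shift L - psi_mass mu)%R => x Fx.
  exact: (potential_total cF delta0 Fdelta L2 aL muF Fx).
split=> -[w [Sw Fw]].
  exists (w - s)%R; split=> x Sx.
    have := Sw x Sx; rewrite pot; last exact: (msupport_sub cF muF).
    by rewrite EFinB => <-; rewrite addeK.
  by have := Fw x Sx; rewrite pot ?EFinB ?leeBlDr//; case: Sx.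
exists (w + s)%R; split=> x Sx.
  rewrite pot; last exact: (msupport_sub cF muF).
  by rewrite (Sw x Sx).
by rewrite pot ?EFinD ?leeD2rE//; [exact: Fw|case: Sx].
Qed.

Lemma equilibrium_measure : exists lambda : P,
  [/\ M1fin F lambda,
      is_minimizer F lambda,
      (forall mu, M1fin F mu -> is_minimizer F mu -> same_measure mu lambda),
      equilibrium F lambda
    & (forall mu, M1fin F mu -> equilibrium F mu -> same_measure mu lambda)].
Proof.
have finE mu : M1fin F mu -> M1 F mu /\ E mu mu < +oo.
  move=> [muF mufin]; split; first exact: muF.
  by rewrite (total_energy_lty cF delta0 Fdelta L2 aL muF).
have [nu0 nu0F nu0fin] : exists2 nu : P, M1 F nu & E nu nu < +oo.
  have [x Fx] := F0; have [b [c [bc bcL _ bcF]]] := Fitv Fx L0.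
  exists (uniform_prob bc : P); first exact: uniform_M1.
  exact: (uniform_energy_fin cF delta0 Fdelta L2 aL bc bcL bcF).
have [lambda lF lmin] : exists2 lambda : P, M1 F lambda &
    forall nu, M1 F nu -> E lambda lambda <= E nu nu.
  by apply: (energy_minimizer mk k0 k_cvg cF a0 Fa); exists nu0.
have lfin : E lambda lambda < +oo := le_lt_trans (lmin nu0 nu0F) nu0fin.
(* One of the two inequalities of [energy_unique], for every competitor of finite energy; minimality
   or equilibrium of the competitor supplies the other. *)
have variation nu : M1 F nu -> E nu nu < +oo -> E lambda lambda <= E nu lambda.
  move=> nuF nufin; rewrite (mutual_energyC nu lambda mk k0 k_sym).
  exact: (first_variation mk k0 k_sym k_pos lF lmin nuF nufin).
exists lambda; split.
- by split; [exact: lF|]; rewrite -(total_energy_lty cF delta0 Fdelta L2 aL lF).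
- exact/minimizerE.
- move=> mu /finE[muF mufin] /(minimizerE muF) mumin.
  apply: energy_unique => //; last exact: variation.
  exact: (first_variation mk k0 k_sym k_pos muF mumin lF lfin).
- apply/(equilibriumE lF).
  have lge0 : 0 <= E lambda lambda by exact: mutual_energy_ge0.
  have lE : E lambda lambda = (fine (E lambda lambda))%:E.
    by rewrite fineK// ge0_fin_numE.
  have FU x : F x -> (fine (E lambda lambda))%:E <= \int[lambda]_t k (x, t).
    rewrite -lE.
    exact: (minimizer_potential_ge cF delta0 Fdelta L2 aL Fitv lF lmin).
  exists (fine (E lambda lambda)); split; last by move=> x [Fx _]; exact: FU.
  apply: (minimizer_support mk k0 k_cvg cF lF) => //; first by rewrite -lE.
  exact: fine_ge0.
- move=> mu /finE[muF mufin] /(equilibriumE muF)[w [Sw Fw]].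
  apply: energy_unique => //; last exact: variation.
  rewrite (mutual_energyC mu lambda mk k0 k_sym).
  exact: (equilibrium_energy mk k0 cF muF Sw Fw lF).
Qed.

End equilibrium_measure.

(** * Finite unions of compact intervals *)

Theorem theorem1 (R : realType) (p : nat) (c d : 'I_p -> R) (F : set R)
    (p_gt0 : (0 < p)%N)
    (lt_cd : forall j, c j < d j)
    (disj : trivIset setT (fun j => [set` `[c j, d j]]))
    (F_def : F = \bigcup_j [set` `[c j, d j]])
    (F_E : F `<=` ~` [set` `[(-1 : R), 1]]) :
  exists lambda : probability (measurableTypeR R) R,
    [/\ M1fin F lambda,
        is_minimizer F lambda,
        (forall mu, M1fin F mu -> is_minimizer F mu -> same_measure mu lambda),
        equilibrium F lambda
      & (forall mu, M1fin F mu -> equilibrium F mu -> same_measure mu lambda)].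
Proof.
have Fj j : `[c j, d j] `<=` F by rewrite F_def => x xj; exists j.
have Fin x : F x -> exists j, c j <= x <= d j.
  by rewrite F_def => -[j _]; rewrite /= in_itv; exists j.
have cF : closed F.
  rewrite F_def; have -> : \bigcup_j [set` `[c j, d j]] =
      \bigcup_(j in [set` finset.setT]) [set` `[c j, d j]].
    by apply: eq_bigcupl; split=> j //= _; rewrite inE.
  apply: closed_bigcup => [|j _]; first exact: finite_finset.
  exact: itv_closed.
have [delta delta0 deltaP] : exists2 delta : R, 0 < delta &
    forall x, F x -> 1 + delta <= `|x|.
  (* F is closed and contains neither 1 nor -1, so it keeps a positive distance from both; for
     points outside [-1, 1] this is the bound |x| >= 1 + delta. *)
  have gap (y : R) : `|y| = 1 -> exists2 e : R, 0 < e & forall x, F x -> e <= `|y - x|.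
    move=> y1; have nFy : ~ F y.
      by move=> /F_E; apply; rewrite /= in_itv/= -ler_norml y1.
    have /nbhs_ballP[e /= e0 eP] : nbhs y (~` F).
      by apply: open_nbhs_nbhs; split=> //; exact: closed_openC.
    exists e => // x Fx; rewrite leNgt; apply/negP => xe.
    exact: (eP x).
  have [e1 e10 e1P] := gap 1 (normr1 _).
  have [e2 e20 e2P] := gap (- 1) (normrN1 _).
  exists (Num.min e1 e2); first by rewrite lt_min e10.
  move=> x Fx; have := e1P x Fx; have := e2P x Fx; have := F_E x Fx.
  rewrite /= in_itv/= => /negP; rewrite negb_and -!ltNge => x1.
  have m1 : Num.min e1 e2 <= e1 by rewrite ge_min lexx.
  have m2 : Num.min e1 e2 <= e2 by rewrite ge_min lexx orbT.
  case/orP: x1 => x1.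
    rewrite (ltr0_norm (_ : x < 0)); last by lra.
    by rewrite (gtr0_norm (_ : 0 < -1 - x)); [lra|lra].
  rewrite (gtr0_norm (_ : 0 < x)); last by lra.
  by rewrite (ltr0_norm (_ : 1 - x < 0)); [lra|lra].
pose a : R := \sum_j (`|c j| + `|d j|).
have Fa x : F x -> `|x| <= a.
  move=> /Fin[j /andP[cx xd]]; apply: (@le_trans _ _ (`|c j| + `|d j|)).
    have := ler_norm (d j); have := ler_norm (- c j); rewrite normrN.
    have := normr_ge0 (d j); have := normr_ge0 (c j).
    by move=> *; apply/ler_normlP; split; lra.
  rewrite /a (bigD1 j)//= lerDl; apply: sumr_ge0 => i _.
  by rewrite addr_ge0.
have a0 : 0 <= a by apply: sumr_ge0 => j _; rewrite addr_ge0.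
(* The value 2 a + 2 meets both requirements L >= 2 and L > 2 a. *)
apply: (@equilibrium_measure R F a delta (a *+ 2 + 2)) => //.
- by move=> x Fx; rewrite deltaP// Fa.
- by rewrite lerDr mulrn_wge0.
- by rewrite ltrDl.
- move=> x e Fx e0; have [j /andP[cx xd]] := Fin x Fx.
  have cd := lt_cd j.
  (* As c j < d j, a short interval inside [c j, d j] starts at x, or ends at x when x is the right
     endpoint. *)
  have [xlt|xge] := ltP x (d j).
    exists x, (Num.min (d j) (x + e)); split.
    + by rewrite lt_min xlt ltrDl.
    + by rewrite lerBlDl ge_min lexx orbT.
    + by rewrite lexx le_min ltW//= lerDl ltW.
    + apply: subset_trans (Fj j) => y /=; rewrite !in_itv/= le_min.
      by move=> /andP[xy /andP[yd _]]; rewrite yd (le_trans cx).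
  exists (Num.max (c j) (x - e)), x; split.
  + by rewrite gt_max (lt_le_trans cd)//= ltrBlDr ltrDl.
  + by rewrite lerBlDr -lerBlDl le_max lexx orbT.
  + by rewrite lexx ge_max cx lerBlDr lerDl ltW.
  + apply: subset_trans (Fj j) => y /=; rewrite !in_itv/= ge_max.
    by move=> /andP[/andP[cy _] yx]; rewrite cy (le_trans yx).
- by exists (c (Ordinal p_gt0)); apply: (Fj (Ordinal p_gt0)); rewrite /= in_itv/= lexx ltW.
Qed.
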